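(* Let $\frac12<s\le 1$. Then the space $\mathcal{E}^s$ is not embedded in $L^p(\mathbb{R}^3)$ for $1\le p<\frac{16s+2}{6s+1}$.
   Context: For $0<s<\frac32$, $\dot H^s(\mathbb{R}^3)$ is the homogeneous Sobolev space, the completion of $C_0^\infty(\mathbb{R}^3)$ (realized as a subspace of $L^{6/(3-2s)}(\mathbb{R}^3)$) for the norm $\|\varphi\|_{\dot H^s(\mathbb{R}^3)}=\left(\int_{\mathbb{R}^3}|\xi|^{2s}|\hat\varphi(\xi)|^2\,d\xi\right)^{1/2}=\|(-\Delta)^{s/2}\varphi\|_{L^2(\mathbb{R}^3)}$ (up to the normalization of the Fourier transform), and $\dot H^s_{rad}(\mathbb{R}^3)$ is its subspace of radially symmetric functions. Define $$\mathcal{E}^s=\left\{\varphi\in\dot H^s_{rad}(\mathbb{R}^3)\ :\ \iint_{\mathbb{R}^3\times\mathbb{R}^3}\frac{|\varphi(x)|^2|\varphi(y)|^2}{|x-y|}\,dx\,dy<\infty\right\},$$ with norm $$\|\varphi\|_{\mathcal{E}^s}=\left(\|\varphi\|_{\dot H^s(\mathbb{R}^3)}^2+\left(\iint_{\mathbb{R}^3\times\mathbb{R}^3}\frac{|\varphi(x)|^2|\varphi(y)|^2}{|x-y|}\,dx\,dy\right)^{\frac12}\right)^{\frac12}.$$ ''Embedded'' means continuously embedded: $\mathcal{E}^s$ is embedded in $L^p(\mathbb{R}^3)$ if $\mathcal{E}^s\subset L^p(\mathbb{R}^3)$ and there is a finite constant $C$ with $\|\varphi\|_{L^p(\mathbb{R}^3)}\le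 C\|\varphi\|_{\mathcal{E}^s}$ for all $\varphi\in\mathcal{E}^s$. *)

(* Defs.v *)
From HB Require Import structures.
From mathcomp Require Import all_boot all_order all_algebra.
From mathcomp Require Import all_classical all_reals all_analysis.
From mathcomp Require Import complex.

Set Implicit Arguments.
Unset Strict Implicit.
Unset Printing Implicit Defensive.

Import Order.TTheory GRing.Theory Num.Theory.
Import numFieldNormedType.Exports.
Import Normc.

Local Open Scope classical_set_scope.
Local Open Scope ring_scope.

(* The library declares the product of two sigma-finite measures to be
   sigma-finite, but an instance for subprobabilities shadows that one, so it is
   stated again here and attached to leb2 and leb3 by name. *)
Lemma sigma_finite_prod d1 d2 (T1 : measurableType d1) (T2 : measurableType d2)
    (R : realType) (m1 : {sigma_finite_measure set T1 -> \bar R})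
    (m2 : {sigma_finite_measure set T2 -> \bar R}) :
  sigma_finite [set: T1 * T2] (m1 \x m2)%E.
Proof.
have /sigma_finiteP[F [TF ndF Foo]] := sigma_finiteT m1.
have /sigma_finiteP[G [TG ndG Goo]] := sigma_finiteT m2.
exists (fun n => F n `*` G n).
  rewrite -setXTT TF TG predeqE => -[x y]; split.
    move=> [/= [n _ Fnx] [k _ Gky]]; exists (maxn n k) => //; split.
    - by move: x Fnx; exact/subsetPset/ndF/leq_maxl.
    - by move: y Gky; exact/subsetPset/ndG/leq_maxr.
  by move=> [n _ []/= ? ?]; split; exists n.
move=> k; have [? ?] := Foo k; have [? ?] := Goo k.
split; first exact: measurableX.
by rewrite product_measure1E// lte_mul_pinfty// ge0_fin_numE.
Qed.

Section LebesgueR3.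
Variable R : realType.

Local Notation M := (measurableTypeR R).

Definition leb2 : set (M * M) -> \bar R :=
  (@lebesgue_measure R \x @lebesgue_measure R)%E.

HB.instance Definition _ := Measure.on leb2.
HB.instance Definition _ := @Measure_isSigmaFinite.Build _ _ _ leb2
  (sigma_finite_prod (@lebesgue_measure R) (@lebesgue_measure R)).

Definition leb3 : set (M * M * M) -> \bar R :=
  (leb2 \x @lebesgue_measure R)%E.

HB.instance Definition _ := Measure.on leb3.
HB.instance Definition _ := @Measure_isSigmaFinite.Build _ _ _ leb3
  (sigma_finite_prod leb2 (@lebesgue_measure R)).

End LebesgueR3.
Arguments leb2 {R}.
Arguments leb3 {R}.

Section Definitions.
Variable R : realType.

(* M is R with its Borel sigma-algebra: R3 carries the topological and
   differential structures, M3 the (convertible) measurable one. *)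
Local Notation R3 := (R * R * R)%type.
Local Notation M := (measurableTypeR R).
Local Notation M3 := (M * M * M)%type.
Local Notation C := (complex R).

(* The library norm on a product type is the maximum norm, so the Euclidean
   structure of R^3 is introduced separately; both give the same topology. *)
Definition dot3 (x y : R3) : R :=
  x.1.1 * y.1.1 + x.1.2 * y.1.2 + x.2 * y.2.

Definition norm3 (x : R3) : R := Num.sqrt (dot3 x x).

(* A function is C^(n+1) iff it is differentiable and all its
   directional derivatives are C^n. *)
Fixpoint is_Ck (n : nat) (f : R3 -> R) : Prop :=
  if n is m.+1 then
    (forall x, differentiable f x) /\
    (forall v : R3, is_Ck m (fun x => 'D_v f x))
  else continuous f.

Definition test_fun (phi : R3 -> C) : Prop :=
  (forall n, is_Ck n (fun x => complex.Re (phi x)) /\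
             is_Ck n (fun x => complex.Im (phi x))) /\
  compact (closure [set x | phi x != 0]).

Definition Cmeasurable (phi : R3 -> C) : Prop :=
  measurable_fun [set: M3] (fun x => complex.Re (phi x)) /\
  measurable_fun [set: M3] (fun x => complex.Im (phi x)).

Definition Lp_norm (p : R) (phi : R3 -> C) : \bar R :=
  ('N[leb3]_p%:E [(fun x : M3 => (normc (phi x))%:E)])%E.

Definition in_Lp (p : R) (phi : R3 -> C) : Prop :=
  Cmeasurable phi /\ (Lp_norm p phi < +oo)%E.

Definition Cintegral (phi : R3 -> C) : C :=
  Complex (\int[leb3]_x complex.Re (phi x)) (\int[leb3]_x complex.Im (phi x)).

(* exp (- i t) *)
Definition cexpN (t : R) : C := Complex (cos t) (- sin t).

(* With this unitary normalization, |xi|^s times the transform of phi has the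
   same L^2 norm as (-Delta)^(s/2) phi. *)
Definition fourier (phi : R3 -> C) (xi : R3) : C :=
  real_complex R ((2 * pi) `^ (- (3 / 2))) *
  Cintegral (fun x => cexpN (dot3 x xi) * phi x).

Definition test_Hs_norm (s : R) (phi : R3 -> C) : \bar R :=
  ((\int[leb3]_xi (norm3 xi `^ (2 * s) * normc (fourier phi xi) ^+ 2)%:E)
     `^ 2^-1)%E.

(* An element of the completion of the test functions, realized in
   L^(6/(3-2s)): u is Cauchy for the homogeneous Sobolev norm and phi is its
   limit in L^(6/(3-2s)). *)
Definition Hs_approx (s : R) (phi : R3 -> C) (u : nat -> R3 -> C) : Prop :=
  [/\ forall n, test_fun (u n),
      forall e : R, 0 < e -> exists N : nat, forall m n : nat,
        (N <= m)%N -> (N <= n)%N ->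
        (test_Hs_norm s (fun x => u m x - u n x)%R < e%:E)%E &
      Lp_norm (6 / (3 - 2 * s)) (fun x => u n x - phi x) @[n --> \oo] -->
        0%E].

Definition in_Hs (s : R) (phi : R3 -> C) : Prop :=
  in_Lp (6 / (3 - 2 * s)) phi /\ exists u, Hs_approx s phi u.

(* The norm of the completion is the limit of the norms along an approximating
   sequence.  It does not depend on the sequence, so that for phi in the space
   the infimum is taken over a singleton. *)
Definition Hs_norm (s : R) (phi : R3 -> C) : \bar R :=
  ereal_inf [set l | exists2 u, Hs_approx s phi u &
                       test_Hs_norm s (u n) @[n --> \oo] --> l].

(* Elements of the space are classes modulo equality almost everywhere. *)
Definition radial (phi : R3 -> C) : Prop :=
  exists f : R -> C, {ae leb3, forall x, phi x = f (norm3 x)}.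

(* On the diagonal the integrand is 0 by the convention 0^-1 = 0; the diagonal
   is negligible. *)
Definition coulomb (phi : R3 -> C) : \bar R :=
  (\int[leb3 \x leb3]_z
    (normc (phi z.1) ^+ 2 * normc (phi z.2) ^+ 2 / norm3 (z.1 - z.2))%:E)%E.

Definition in_Es (s : R) (phi : R3 -> C) : Prop :=
  [/\ in_Hs s phi, radial phi & (coulomb phi < +oo)%E].

Definition Es_norm (s : R) (phi : R3 -> C) : \bar R :=
  ((Hs_norm s phi ^+ 2 + coulomb phi `^ 2^-1) `^ 2^-1)%E.

Definition Es_embedded (s p : R) : Prop :=
  exists K : R, forall phi : R3 -> C, in_Es s phi ->
    in_Lp p phi /\ (Lp_norm p phi <= K%:E * Es_norm s phi)%E.

End Definitions.

(* Main.v *)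
From HB Require Import structures.
Require Import Defs.
From mathcomp Require Import all_boot all_order all_algebra.
From mathcomp Require Import all_classical all_reals all_analysis.
From mathcomp Require Import measurable_realfun complex ring lra.

Set Implicit Arguments.
Unset Strict Implicit.
Unset Printing Implicit Defensive.

Import Order.TTheory GRing.Theory Num.Theory.
Import numFieldNormedType.Exports.
Import Normc.

Local Open Scope classical_set_scope.
Local Open Scope ring_scope.

(** The counterexamples are smoothed spherical shells of radius [lam],
    thickness [S] and height [amp],
      [amp * flat (1 - ((|x|^2 - lam^2) / (lam * S))^2)],
    [flat] being [exp (- 1 / t)] for [t > 0] and [0] otherwise.  Up to
    constants, the L^p norm to the power [p] is at least [amp^p lam^2 S], the
    Coulomb energy is at most [amp^4 lam^3 S^2], and interpolating between L^2
    and H^1 through [|xi|^(2s) <= S^(-2s) (1 + S^2 |xi|^2)] bounds the square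
    of the homogeneous Sobolev norm by [amp^2 lam^2 S^(1-2s)].  For
    [lam = S^(4s)] and [amp = S^(-(6s+1)/2)] the last two quantities are
    bounded, whereas the first one is [S^(8s + 1 - p (6s+1)/2)], which is
    unbounded as [S] grows exactly when [p < (16s+2)/(6s+1)]. *)

(** * Smoothness of the profile *)

(** The exponents of [S] solve two equations. Ask that [amp^2 lam^2 S^(1-2s)] and [amp^4 lam^3 S^2]
    both be 1: dividing the square of the first by the second gives [lam = S^(4s)], and then
    [amp^2 = S^(-(6s+1))]. The condition [1/2 < s] makes the radius at least [S^2] for large [S],
    and the geometry rests on the resulting [4 * S <= lam]. Only an upper bound on the Sobolev norm
    matters, so Plancherel is proved as an inequality with a constant. It follows from a Schur test
    on a weighted frequency integral, provided the kernel created by the weight is integrable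
    uniformly in the cut-off; this dictates a weight that vanishes continuously at the ends of its
    interval. The Coulomb energy is the volume [lam^2 S] of the shell times a bound [lam S] for its
    potential, the order of magnitude that this volume creates at distance [lam]. Both factors come
    from vertical slices of length [O(S)], with permutations of the coordinates in the role of
    rotations. *)

Section Flat.
Variable R : realType.
Implicit Types (P : {poly R}) (t : R).

(** The polynomial factor makes the family closed under differentiation: the derivative of
    [P(1/t) exp(-1/t)] has the same form, with polynomial [X^2 (P - P')]. *)
Definition flat P t : R :=
  if 0 < t then P.[t^-1] * expR (- t^-1) else 0.

Definition flat_deriv P : {poly R} := 'X^2 * (P - P^`()).

(** One term of the exponential series gives [y^k exp(-y) <= k!], which is summed over the monomials
    of [P]. *)
Lemma poly_expR_bound P : exists2 C : R, 0 <= C &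
  forall y, 0 <= y -> `|P.[y]| * expR (- y) <= C.
Proof.
have mono k (y : R) : 0 <= y -> y ^+ k * expR (- y) <= k`!%:R.
  move=> y0; rewrite expRN ler_pdivrMr ?expR_gt0//.
  case: k => [|k].
    by rewrite expr0 fact0 mul1r (le_trans _ (expR_ge1Dx _))// lerDl.
  have h := expR_ge1Dxn k y0.
  rewrite mulrC -ler_pdivrMr ?ltr0n ?fact_gt0//.
  by apply: le_trans h; rewrite lerDr.
exists (\sum_(i < size P) `|P`_i| * (i`!)%:R).
  by apply: sumr_ge0 => i _; rewrite mulr_ge0.
move=> y y0; rewrite horner_coef.
apply: (@le_trans _ _ ((\sum_(i < size P) `|P`_i| * y ^+ i) * expR (- y))).
  rewrite ler_wpM2r ?expR_ge0//; apply: le_trans (ler_norm_sum _ _ _) _.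
  by apply: ler_sum => i _; rewrite normrM normrX (ger0_norm y0).
rewrite mulr_suml; apply: ler_sum => i _.
by rewrite -mulrA ler_wpM2l ?mono.
Qed.

(** The previous bound for [P * X^2] absorbs the factor [t^-2]. Quadratic decay is what makes the
    derivative at 0 exist and vanish. *)
Lemma flat_bound P : exists2 C : R, 0 <= C & forall t, `|flat P t| <= C * t ^+ 2.
Proof.
have [C C0 hC] := poly_expR_bound (P * 'X^2); exists C => // t.
rewrite /flat; case: ltP => t0; last by rewrite normr0 mulr_ge0 ?sqr_ge0.
have ti0 : 0 <= t^-1 by rewrite invr_ge0 ltW.
have := hC _ ti0.
rewrite hornerM hornerXn normrM (ger0_norm (exprn_ge0 2 ti0)) => h.
rewrite normrM (ger0_norm (expR_ge0 _)).
rewrite -ler_pdivrMr ?exprn_gt0//; apply: le_trans h.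
by rewrite exprVn mulrAC.
Qed.

Lemma is_derive_flat P t : is_derive t 1 (flat P) (flat (flat_deriv P) t).
Proof.
have [t0|t0|->] := ltgtP t 0.
- apply: (@near_eq_is_derive R R R (cst 0)).
    near=> x; rewrite /flat ifF//; apply/negbTE; rewrite -leNgt ltW//.
    by near: x; exact: lt_nbhsl.
  by rewrite /flat ltNge ltW//=; exact: is_derive_cst.
- apply: (@near_eq_is_derive R R R (fun x : R => P.[x^-1] * expR (- x^-1))).
    near=> x; rewrite /flat ifT//.
    by near: x; exact: lt_nbhsr.
  have dV : is_derive t 1 (fun x : R => x^-1) (- t ^- 2).
    have := @is_deriveV R id t 1 1; rewrite gt_eqF// => /(_ isT (is_derive_id _ _)).
    by rewrite /GRing.scale/= mulr1.
  have dP : is_derive t 1 (fun x : R => P.[x^-1]) (P^`().[t^-1] * (- t ^- 2)).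
    exact: (@is_derive1_comp _ (horner P)).
  have dE : is_derive t 1 (fun x : R => expR (- x^-1)) (expR (- t^-1) * (- - t ^- 2)).
    apply: (@is_derive1_comp _ expR); exact: is_deriveN.
  apply: is_derive_eq.
  rewrite /flat t0 /flat_deriv hornerM hornerXn hornerD hornerN /GRing.scale/=.
  rewrite exprVn; ring.
(* At 0, the slope function takes the value 0 by the convention [0^-1 = 0] and is continuous there
   by [flat_bound]. *)
- apply/is_derive1_caratheodory; exists (fun z => flat P z / z).
  have f0 Q : flat Q 0 = 0 by rewrite /flat ltxx.
  split.
  + move=> z; rewrite f0 !subr0; have [->|z0] := eqVneq z 0.
      by rewrite f0 mulr0.
    by rewrite divfK.
  + have [C C0 hC] := flat_bound P.
    rewrite /prop_for/= /continuous_at/= invr0 mulr0; apply/cvgrPdist_le => /= e e0.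
    near=> z; rewrite sub0r normrN normrM.
    have [->|z0] := eqVneq z 0; first by rewrite f0 normr0 mul0r ltW.
    rewrite normfV ler_pdivrMr ?normr_gt0//; apply: le_trans (hC z) _.
    rewrite -normr_gt0 in z0.
    rewrite -(@ger0_norm _ (z ^+ 2)) ?sqr_ge0// normrX expr2 mulrA ler_pM2r//.
    (* [C + 1] rather than [C], since [C] may be 0. *)
    have h : `|z| <= e / (C + 1).
      near: z.
      have ec : 0 < e / (C + 1) by rewrite divr_gt0// ltr_wpDl.
      apply/nbhs_normP; exists (e / (C + 1)) => //= y /=.
      by rewrite /ball_/= sub0r normrN => /ltW.
    rewrite ler_pdivlMr in h; last by rewrite ltr_wpDl.
    rewrite mulrC; apply: le_trans h; rewrite ler_wpM2l//; lra.
  + by rewrite !f0 mul0r.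
Unshelve. all: by end_near. Qed.

Lemma flat1_ge0 t : 0 <= flat 1 t.
Proof. by rewrite /flat; case: ifP => // _; rewrite hornerC mul1r expR_ge0. Qed.

Lemma flat1_le1 t : flat 1 t <= 1.
Proof.
rewrite /flat; case: ifP => // t0; rewrite hornerC mul1r -expR0 ler_expR.
by rewrite oppr_le0 invr_ge0 ltW.
Qed.

End Flat.

Section SmoothExpr.
Variable R : realType.
Local Notation R3 := (R * R * R)%type.

(* A class closed under directional derivatives: [smooth_expr_Ck] is then a
   plain induction on the order of differentiability. *)
Inductive smooth_expr : (R3 -> R) -> Prop :=
| SE_cst c : smooth_expr (fun=> c)
| SE_x : smooth_expr (fun x => x.1.1)
| SE_y : smooth_expr (fun x => x.1.2)
| SE_z : smooth_expr (fun x => x.2)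
| SE_add f g : smooth_expr f -> smooth_expr g -> smooth_expr (fun x => f x + g x)
| SE_mul f g : smooth_expr f -> smooth_expr g -> smooth_expr (fun x => f x * g x)
| SE_flat P f : smooth_expr f -> smooth_expr (fun x => flat P (f x)).

Lemma eq_smooth_expr f g : f =1 g -> smooth_expr f -> smooth_expr g.
Proof. by move=> /funext ->. Qed.

(** Serves the three coordinate functions: a continuous linear map is its own differential, so its
    directional derivatives are constant. *)
Lemma smooth_expr_lin (f : {linear R3 -> R}) :
  continuous f -> (forall v, smooth_expr (fun=> f v)) ->
  (forall x, differentiable f x) /\ forall v, smooth_expr (fun x => 'D_v f x).
Proof.
move=> cf sf; split=> [x|v]; first exact: linear_differentiable.
apply: (@eq_smooth_expr (fun=> f v)) => // x.
by rewrite deriveE ?diff_lin//; exact: linear_differentiable.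
Qed.

Lemma smooth_expr_derive f : smooth_expr f ->
  (forall x, differentiable f x) /\ forall v, smooth_expr (fun x => 'D_v f x).
Proof.
elim=> [c||||{}f g _ [df sf] _ [dg sg]|{}f g Sf [df sf] Sg [dg sg]|P {}f Sf [df sf]].
- split=> // v; apply: (@eq_smooth_expr (fun=> 0)); last exact: SE_cst.
  by move=> x; rewrite derive_cst.
- pose l (x : R3) := x.1.1.
  have ll : linear l by [].
  pose L := HB.pack_for {linear R3 -> R} l (GRing.isLinear.Build _ _ _ _ _ ll).
  apply: (@smooth_expr_lin L) => [x|v]; last exact: SE_cst.
  by apply: (@cvg_comp _ _ _ fst fst); [exact: cvg_fst|exact: cvg_fst].
- pose l (x : R3) := x.1.2.
  have ll : linear l by [].
  pose L := HB.pack_for {linear R3 -> R} l (GRing.isLinear.Build _ _ _ _ _ ll).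
  apply: (@smooth_expr_lin L) => [x|v]; last exact: SE_cst.
  by apply: (@cvg_comp _ _ _ fst snd); [exact: cvg_fst|exact: cvg_snd].
- pose l (x : R3) := x.2.
  have ll : linear l by [].
  pose L := HB.pack_for {linear R3 -> R} l (GRing.isLinear.Build _ _ _ _ _ ll).
  apply: (@smooth_expr_lin L) => [x|v]; last exact: SE_cst.
  exact: cvg_snd.
- split=> [x|v]; first exact: differentiableD.
  apply: (@eq_smooth_expr (fun x => 'D_v f x + 'D_v g x)); last exact: SE_add.
  by move=> x; rewrite deriveD//; exact: diff_derivable.
- split=> [x|v]; first exact: differentiableM.
  apply: (@eq_smooth_expr (fun x => f x * 'D_v g x + g x * 'D_v f x)); last first.
    by apply: SE_add; exact: SE_mul.
  by move=> x; rewrite deriveM//; exact: diff_derivable.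
- have dP y : differentiable (flat P) y.
    by apply/derivable1_diffP; have [] := is_derive_flat P y.
  split=> [x|v]; first exact: differentiable_comp.
  apply: (@eq_smooth_expr (fun x => flat (flat_deriv P) (f x) * 'D_v f x)); last first.
    by apply: SE_mul; [exact: SE_flat|exact: sf].
  move=> x; rewrite deriveE; last exact: differentiable_comp.
  rewrite [in RHS]deriveE// -[fun y => flat P (f y)]/(flat P \o f).
  rewrite (diff_comp (df x) (dP _))/= diff1E// mulrC derive1E.
    by have [_ ->] := is_derive_flat P (f x).
  exact: differentiable_comp.
Qed.

Lemma smooth_expr_Ck f n : smooth_expr f -> is_Ck n f.
Proof.
elim: n f => [|n IH] f /smooth_expr_derive[df sf].
  by move=> x; exact: differentiable_continuous.
by split=> // v; exact: IH.
Qed.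

End SmoothExpr.

(** * Iterated integrals on R^3 *)

Section Leb3.
Variable R : realType.
Local Notation M := (measurableTypeR R).
Local Notation M3 := (M * M * M)%type.
Local Notation mu := (@lebesgue_measure R).
Local Open Scope ereal_scope.

Lemma integral_leb3 (f : M3 -> \bar R) : measurable_fun [set: M3] f ->
  (forall x, 0 <= f x) ->
  \int[leb3]_x f x = \int[mu]_a \int[mu]_b \int[mu]_c f ((a, b), c).
Proof.
move=> mf f0.
rewrite [LHS](@fubini_tonelli1 _ _ (M * M)%type M R leb2 mu f mf f0).
rewrite [LHS](@fubini_tonelli1 _ _ M M R mu mu) //.
  exact: (@measurable_fun_fubini_tonelli_F _ _ (M * M)%type M R mu f mf f0).
by move=> x; exact: integral_ge0.
Qed.

Lemma integral_leb3_swap23 (f : M3 -> \bar R) : measurable_fun [set: M3] f ->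
  (forall x, 0 <= f x) ->
  \int[leb3]_x f x = \int[leb3]_x f ((x.1.1, x.2), x.1.2).
Proof.
move=> mf f0.
have mf' : measurable_fun [set: M3] (fun x : M3 => f ((x.1.1, x.2), x.1.2)).
  apply: measurableT_comp mf _; apply: measurable_fun_pair.
    apply: measurable_fun_pair => //.
    exact: measurableT_comp measurable_fst measurable_fst.
  exact: measurableT_comp measurable_snd measurable_fst.
apply: (etrans (integral_leb3 mf f0)).
apply: (etrans _ (esym (integral_leb3 mf' (fun x => f0 _)))); apply: eq_integral => a _.
rewrite (@fubini_tonelli _ _ M M R mu mu (fun z => f ((a, z.1), z.2)))//.
apply: measurableT_comp mf _; apply: measurable_fun_pair => //.
by apply: measurable_fun_pair.
Qed.

Lemma integral_leb3_swap12 (f : M3 -> \bar R) : measurable_fun [set: M3] f ->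
  (forall x, 0 <= f x) ->
  \int[leb3]_x f x = \int[leb3]_x f ((x.1.2, x.1.1), x.2).
Proof.
move=> mf f0.
have mf' : measurable_fun [set: M3] (fun x : M3 => f ((x.1.2, x.1.1), x.2)).
  apply: measurableT_comp mf _; apply: measurable_fun_pair => //.
  apply: measurable_fun_pair => //.
    exact: measurableT_comp measurable_snd measurable_fst.
  exact: measurableT_comp measurable_fst measurable_fst.
apply: (etrans (integral_leb3 mf f0)).
apply: (etrans _ (esym (integral_leb3 mf' (fun x => f0 _)))).
rewrite (@fubini_tonelli _ _ M M R mu mu (fun z => \int[mu]_c f ((z.1, z.2), c)))//.
  have := @measurable_fun_fubini_tonelli_F _ _ (M * M)%type M R mu f mf f0.
  by congr measurable_fun; apply/funext => -[].
by move=> x; exact: integral_ge0.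
Qed.

(** The two transpositions generate all permutations of the coordinates. Through them an estimate in
    the third direction is transferred to the other two. *)
Definition swap23 (x : M3) : M3 := ((x.1.1, x.2), x.1.2).
Definition swap12 (x : M3) : M3 := ((x.1.2, x.1.1), x.2).

(** Signed version, meant for Fourier integrals: the positive and negative parts are transported
    separately. *)
Lemma integral_swap23 (f : M3 -> \bar R) : measurable_fun [set: M3] f ->
  \int[leb3]_x f x = \int[leb3]_x f (swap23 x).
Proof.
move=> mf; apply: (etrans (integralE _ _ _)); apply: (etrans _ (esym (integralE _ _ _))).
congr (_ - _).
  by apply: (etrans (integral_leb3_swap23 (measurable_funepos mf) (fun x => funepos_ge0 f
    x))); apply: eq_integral => x _; rewrite !funeposE.
by apply: (etrans (integral_leb3_swap23 (measurable_funeneg mf) (fun x => funeneg_ge0 f x)));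
  apply: eq_integral => x _; rewrite !funenegE.
Qed.

Lemma integral_swap12 (f : M3 -> \bar R) : measurable_fun [set: M3] f ->
  \int[leb3]_x f x = \int[leb3]_x f (swap12 x).
Proof.
move=> mf; apply: (etrans (integralE _ _ _)); apply: (etrans _ (esym (integralE _ _ _))).
congr (_ - _).
  by apply: (etrans (integral_leb3_swap12 (measurable_funepos mf) (fun x => funepos_ge0 f
    x))); apply: eq_integral => x _; rewrite !funeposE.
by apply: (etrans (integral_leb3_swap12 (measurable_funeneg mf) (fun x => funeneg_ge0 f x)));
  apply: eq_integral => x _; rewrite !funenegE.
Qed.

Lemma integral_leb3_prod (a b c : M -> R) :
  measurable_fun [set: M] a -> measurable_fun [set: M] b -> measurable_fun [set: M] c ->
  (forall t, 0 <= a t)%R -> (forall t, 0 <= b t)%R -> (forall t, 0 <= c t)%R ->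
  \int[leb3]_x (a x.1.1 * b x.1.2 * c x.2)%:E =
  (\int[mu]_t (a t)%:E) * (\int[mu]_t (b t)%:E) * (\int[mu]_t (c t)%:E).
Proof.
move=> ma mb mc a0 b0 c0.
have mE (f : M -> R) : measurable_fun [set: M] f -> measurable_fun [set: M] (EFin \o f).
  by move=> mf; exact/measurable_EFinP.
have i0 (f : M -> R) : (forall t, 0 <= f t)%R -> 0 <= \int[mu]_t (f t)%:E.
  by move=> f0; apply: integral_ge0 => t _; rewrite lee_fin.
rewrite integral_leb3; last 2 first.
- apply/measurable_EFinP; apply: measurable_funM; [apply: measurable_funM|].
  + by apply: measurableT_comp ma _; exact: measurableT_comp measurable_fst measurable_fst.
  + by apply: measurableT_comp mb _; exact: measurableT_comp measurable_snd measurable_fst.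
  + exact: measurableT_comp mc measurable_snd.
- by move=> x; rewrite lee_fin !mulr_ge0.
transitivity (\int[mu]_s ((a s)%:E *
    ((\int[mu]_t (b t)%:E) * \int[mu]_t (c t)%:E))).
  apply: eq_integral => s _ /=.
  transitivity (\int[mu]_t ((a s)%:E * ((\int[mu]_u (c u)%:E) * (b t)%:E))).
    apply: eq_integral => t _ /=.
    under eq_integral do rewrite EFinM.
    rewrite ge0_integralZl//.
    - by rewrite EFinM -muleA [X in _ * X]muleC.
    - exact: mE.
    - by move=> x _; rewrite lee_fin.
    - by rewrite lee_fin mulr_ge0.
  rewrite ge0_integralZl//.
  - rewrite ge0_integralZl//.
    + by congr (_ * _); rewrite muleC.
    + exact: mE.
    + by move=> t _; rewrite lee_fin.
    + exact: i0.
  - by apply: emeasurable_funM => //; exact: mE.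
  - by move=> t _; rewrite mule_ge0 ?lee_fin ?i0.
  - by rewrite lee_fin.
rewrite ge0_integralZr ?muleA//.
- exact: mE.
- by move=> t _; rewrite lee_fin.
- by rewrite mule_ge0 ?i0.
Qed.

End Leb3.

(** * Dominated Fubini theorems *)

Section Dominated.
Context d1 d2 (X : measurableType d1) (Y : measurableType d2) (R : realType).
Variables (m1 : {sigma_finite_measure set X -> \bar R})
  (m2 : {sigma_finite_measure set Y -> \bar R}).
Implicit Types (g : X * Y -> R) (a : X -> R) (b : Y -> R).

Lemma integrable_dom d (T : measurableType d) (m : {measure set T -> \bar R})
    (f a : T -> R) :
  measurable_fun [set: T] f -> m.-integrable [set: T] (EFin \o a) ->
  (forall x, `|f x| <= a x) -> m.-integrable [set: T] (EFin \o f).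
Proof.
move=> mf ia fa; apply: le_integrable ia => //.
  exact/measurable_EFinP.
by move=> x _ /=; rewrite lee_fin (le_trans (fa x))// ler_norm.
Qed.

(** Since [cos] and [sin] are bounded by 1, the integrands below have majorants of product form
    [a x * b y]; such a majorant controls each section as well as the double integral. *)
Lemma integrable_section1 g a b x : measurable_fun [set: X * Y] g ->
  m2.-integrable [set: Y] (EFin \o b) ->
  (forall x y, `|g (x, y)| <= a x * b y) ->
  m2.-integrable [set: Y] (EFin \o (fun y => g (x, y))).
Proof.
move=> mg ib gab; apply: (@integrable_dom _ _ _ _ (fun y => a x * b y)).
- exact: measurableT_comp mg _.
- by apply: eq_integrable (integrableZl measurableT (a x) ib).
- by move=> y; exact: gab.
Qed.

Lemma integrable_section2 g a b y : measurable_fun [set: X * Y] g ->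
  m1.-integrable [set: X] (EFin \o a) ->
  (forall x y, `|g (x, y)| <= a x * b y) ->
  m1.-integrable [set: X] (EFin \o (fun x => g (x, y))).
Proof.
move=> mg ia gab; apply: (@integrable_dom _ _ _ _ (fun x => b y * a x)).
- exact: measurableT_comp mg _.
- by apply: eq_integrable (integrableZl measurableT (b y) ia).
- by move=> x; rewrite mulrC; exact: gab.
Qed.

Lemma integrable_prod_dom g a b : measurable_fun [set: X * Y] g ->
  m1.-integrable [set: X] (EFin \o a) -> m2.-integrable [set: Y] (EFin \o b) ->
  (forall x y, `|g (x, y)| <= a x * b y) ->
  (m1 \x m2)%E.-integrable [set: X * Y] (EFin \o g).
Proof.
move=> mg ia ib gab.
have ma : measurable_fun setT a by exact/measurable_EFinP/measurable_int/ia.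
have mb : measurable_fun setT b by exact/measurable_EFinP/measurable_int/ib.
apply/integrable12ltyP; first exact/measurable_EFinP.
have Ib : (\int[m2]_y `|(b y)%:E| < +oo)%E by have /integrableP[] := ib.
have Ia : (\int[m1]_x `|(a x)%:E| < +oo)%E by have /integrableP[] := ia.
apply: (@le_lt_trans _ _ (\int[m1]_x (`|(a x)%:E| * \int[m2]_y `|(b y)%:E|))%E).
  apply: ge0_le_integral => //.
  - by move=> x _; exact: integral_ge0.
  - apply: (@measurable_fun_fubini_tonelli_F _ _ _ _ _ m2 (fun z => `|(g z)%:E|%E)) => //.
    by apply: measurableT_comp => //; exact/measurable_EFinP.
  - apply: emeasurable_funM => //.
    by apply: measurableT_comp => //; exact/measurable_EFinP.
  move=> x _; rewrite -ge0_integralZl//; last first.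
    by apply: measurableT_comp => //; exact/measurable_EFinP.
  apply: ge0_le_integral => //.
  - apply: measurableT_comp => //; apply/measurable_EFinP.
    exact: measurableT_comp mg _.
  - apply: emeasurable_funM => //.
    by apply: measurableT_comp => //; exact/measurable_EFinP.
  - move=> y _ /=; rewrite -EFinM lee_fin -normrM.
    by rewrite (le_trans (gab x y))// ler_norm.
rewrite ge0_integralZr//; last 2 first.
- by apply: measurableT_comp => //; exact/measurable_EFinP.
- exact: integral_ge0.
by rewrite lte_mul_pinfty// ?integral_ge0// ge0_fin_numE// integral_ge0.
Qed.

Lemma Rintegral_swap g a b : measurable_fun [set: X * Y] g ->
  m1.-integrable [set: X] (EFin \o a) -> m2.-integrable [set: Y] (EFin \o b) ->
  (forall x y, `|g (x, y)| <= a x * b y) ->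
  \int[m1]_x (\int[m2]_y g (x, y)) = \int[m2]_y (\int[m1]_x g (x, y)).
Proof.
move=> mg ia ib gab.
have := Fubini (integrable_prod_dom mg ia ib gab).
rewrite {1 4}/Rintegral => H; congr fine; transitivity
    (\int[m1]_x \int[m2]_y (EFin \o g) (x, y))%E.
  apply: eq_integral => x _; rewrite /Rintegral fineK//.
  by apply: integrable_fin_num => //; exact: integrable_section1 mg ib gab.
rewrite H; apply: eq_integral => x _; rewrite /Rintegral fineK//.
by apply: integrable_fin_num => //; exact: integrable_section2 mg ia gab.
Qed.

Lemma Rintegral_prod g a b : measurable_fun [set: X * Y] g ->
  m1.-integrable [set: X] (EFin \o a) -> m2.-integrable [set: Y] (EFin \o b) ->
  (forall x y, `|g (x, y)| <= a x * b y) ->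
  \int[(m1 \x m2)%E]_z g z = \int[m1]_x (\int[m2]_y g (x, y)).
Proof.
move=> mg ia ib gab; rewrite {1}/Rintegral.
rewrite -[X in fine X](integral12_prod_meas1 (integrable_prod_dom mg ia ib gab)).
congr fine; apply: eq_integral => x _; rewrite /fubini_F fineK//.
by apply: integrable_fin_num => //; exact: integrable_section1 mg ib gab.
Qed.

(** Adding the majorant [b] makes the integrand nonnegative, so that Tonelli provides the
    measurability; the integral of [b] is then a constant to subtract. *)
Lemma measurable_Rintegral g b : measurable_fun [set: X * Y] g ->
  m2.-integrable [set: Y] (EFin \o b) -> (forall x y, `|g (x, y)| <= b y) ->
  measurable_fun [set: X] (fun x => \int[m2]_y g (x, y)).
Proof.
move=> mg ib gb.
have mb : measurable_fun setT b by exact/measurable_EFinP/measurable_int/ib.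
have gb1 x y : `|g (x, y)| <= 1 * b y by rewrite mul1r.
have -> : (fun x => \int[m2]_y g (x, y)) =
   (fun x => \int[m2]_y (g (x, y) + b y) - \int[m2]_y b y).
  apply/funext => x; rewrite RintegralD ?addrK//.
  exact: (integrable_section1 x mg ib gb1).
apply: measurable_funB => //.
apply: measurableT_comp => //.
apply: (@measurable_fun_fubini_tonelli_F _ _ _ _ _ m2 (fun z => (g z + b z.2)%:E)).
  apply/measurable_EFinP/measurable_funD => //.
  exact: measurableT_comp mb measurable_snd.
move=> [x y] /=; rewrite lee_fin -lerBlDr sub0r.
by rewrite (le_trans _ (lerNnormlW (gb x y))) ?lerN2.
Qed.

End Dominated.

(** * A Schur test for Fourier integrals *)

Section Bessel.
Context d1 d2 (X : measurableType d1) (Y : measurableType d2) (R : realType).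
Variables (m1 : {sigma_finite_measure set X -> \bar R})
  (m2 : {sigma_finite_measure set Y -> \bar R}).
Variables (f : X -> R) (w : Y -> R) (th : X * Y -> R).
Hypothesis f_int : m1.-integrable [set: X] (EFin \o f).
Hypothesis w_int : m2.-integrable [set: Y] (EFin \o w).
Hypothesis w_ge0 : forall y, 0 <= w y.
Hypothesis mth : measurable_fun [set: X * Y] th.

(** [Fc] and [Fs] are, up to sign, the real and imaginary parts of the Fourier integral of [f] with
    phase [th]. [J] is the kernel of the weighted transform followed by its adjoint. *)
Local Notation Fc y := (\int[m1]_x (f x * cos (th (x, y)))).
Local Notation Fs y := (\int[m1]_x (f x * sin (th (x, y)))).
Local Notation N1 := (\int[m1]_x `|f x|).
Local Notation J x x' := (\int[m2]_y (w y * cos (th (x, y) - th (x', y)))).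

Let mf : measurable_fun [set: X] f.
Proof. exact/measurable_EFinP/measurable_int/f_int. Qed.

Let mw : measurable_fun [set: Y] w.
Proof. exact/measurable_EFinP/measurable_int/w_int. Qed.

Let nf_int : m1.-integrable [set: X] (EFin \o (fun x => `|f x|)).
Proof. exact: (integrable_abse f_int). Qed.

Let mcos : measurable_fun [set: R] (@cos R).
Proof. by apply: continuous_measurable_fun; exact: continuous_cos. Qed.

Let msin : measurable_fun [set: R] (@sin R).
Proof. by apply: continuous_measurable_fun; exact: continuous_sin. Qed.

Let cos1 (t : R) : `|cos t| <= 1.
Proof. by rewrite ler_norml cos_geN1 cos_le1. Qed.

Let sin1 (t : R) : `|sin t| <= 1.
Proof. by rewrite ler_norml sin_geN1 sin_le1. Qed.

Let mgc : measurable_fun [set: Y * X] (fun z => f z.2 * cos (th (z.2, z.1))).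
Proof.
apply: measurable_funM; first exact: measurableT_comp mf measurable_snd.
apply: measurableT_comp mcos _; apply: measurableT_comp mth _.
exact: measurable_fun_pair.
Qed.

Let mgs : measurable_fun [set: Y * X] (fun z => f z.2 * sin (th (z.2, z.1))).
Proof.
apply: measurable_funM; first exact: measurableT_comp mf measurable_snd.
apply: measurableT_comp msin _; apply: measurableT_comp mth _.
exact: measurable_fun_pair.
Qed.

Let mFc : measurable_fun [set: Y] (fun y => Fc y).
Proof.
apply: (measurable_Rintegral mgc nf_int) => y x /=.
by rewrite normrM ler_piMr.
Qed.

Let mFs : measurable_fun [set: Y] (fun y => Fs y).
Proof.
apply: (measurable_Rintegral mgs nf_int) => y x /=.
by rewrite normrM ler_piMr.
Qed.

Let intc (g : X -> R) : measurable_fun [set: X] g -> (forall x, `|g x| <= 1) ->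
  m1.-integrable [set: X] (EFin \o (fun x => f x * g x)).
Proof.
move=> mg g1; apply: (integrable_dom _ nf_int); first exact: measurable_funM.
by move=> x; rewrite normrM ler_piMr.
Qed.

Let mcx y : measurable_fun [set: X] (fun x => cos (th (x, y))).
Proof. by apply: measurableT_comp mcos _; exact: measurableT_comp mth _. Qed.

Let msx y : measurable_fun [set: X] (fun x => sin (th (x, y))).
Proof. by apply: measurableT_comp msin _; exact: measurableT_comp mth _. Qed.

Let le_norm_int (g : X -> R) : measurable_fun [set: X] g ->
  (forall x, `|g x| <= 1) -> `|\int[m1]_x (f x * g x)| <= N1.
Proof.
move=> mg g1; apply: le_trans (le_normr_Rintegral _ (intc mg g1)) _ => //.
apply: le_Rintegral => //; first exact: (integrable_abse (intc mg g1)).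
by move=> x _; rewrite normrM ler_piMr.
Qed.

Let N1_ge0 : 0 <= N1.
Proof. by apply: Rintegral_ge0. Qed.

(** Expanding one factor of the squared modulus: [Fc y ^+ 2 + Fs y ^+ 2] is the integral of
    [f x * H x y] over [x]. The other factor is expanded in [HE], by the addition formula for
    [cos]. *)
Let H x y := cos (th (x, y)) * Fc y + sin (th (x, y)) * Fs y.

Let HE x y : H x y = \int[m1]_x' (f x' * cos (th (x, y) - th (x', y))).
Proof.
rewrite /H -RintegralZl//; last exact: intc.
rewrite -RintegralZl//; last exact: intc.
rewrite -RintegralD//; last 2 first.
- by apply: eq_integrable (integrableZl measurableT (cos (th (x, y))) (intc (mcx y) (fun x =>
  cos1 _))).
- by apply: eq_integrable (integrableZl measurableT (sin (th (x, y))) (intc (msx y) (fun x =>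
  sin1 _))).
by apply: eq_Rintegral => x' _; rewrite cosB; ring.
Qed.

Let H_le x y : `|H x y| <= N1.
Proof.
rewrite HE; apply: le_norm_int => //.
apply: measurableT_comp mcos _; apply: measurable_funB => //.
exact: measurableT_comp mth _.
Qed.

Let mJ : measurable_fun [set: X * X] (fun z => J z.1 z.2).
Proof.
pose g (z : (X * X) * Y) := w z.2 * cos (th (z.1.1, z.2) - th (z.1.2, z.2)).
apply: (@measurable_Rintegral _ _ _ _ _ m2 g w _ w_int).
  apply: measurable_funM; first exact: measurableT_comp mw measurable_snd.
  apply: measurableT_comp mcos _; apply: measurable_funB.
    apply: measurableT_comp mth _; apply: measurable_fun_pair => //.
    exact: measurableT_comp measurable_fst measurable_fst.
  apply: measurableT_comp mth _; apply: measurable_fun_pair => //.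
  exact: measurableT_comp measurable_snd measurable_fst.
by move=> z y /=; rewrite normrM (ger0_norm (w_ge0 y)) ler_piMr.
Qed.

Let intFE y : w y * (Fc y ^+ 2 + Fs y ^+ 2) = \int[m1]_x (w y * f x * H x y).
Proof.
transitivity (\int[m1]_x (w y * Fc y * (f x * cos (th (x, y)))
   + w y * Fs y * (f x * sin (th (x, y))))).
  rewrite RintegralD//; last 2 first.
  - by apply: eq_integrable (integrableZl measurableT _ (intc (mcx y) (fun x => cos1 _))).
  - by apply: eq_integrable (integrableZl measurableT _ (intc (msx y) (fun x => sin1 _))).
  rewrite RintegralZl ?RintegralZl//; [ring|exact: intc|exact: intc].
by apply: eq_Rintegral => x _; rewrite /H; ring.
Qed.

(** The squared modulus is a double integral over [x] and [x']; integrating over [y] first leaves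
    [J]. Both exchanges are dominated because [f] and [w] are integrable. *)
Lemma Rintegral_quadratic_kernel :
  \int[m2]_y (w y * (Fc y ^+ 2 + Fs y ^+ 2)) =
  \int[m1]_x \int[m1]_x' (f x * f x' * J x x').
Proof.
under eq_Rintegral do rewrite intFE.
have mH : measurable_fun [set: Y * X] (fun z => H z.2 z.1).
  apply: measurable_funD; apply: measurable_funM.
  - apply: measurableT_comp mcos _; apply: measurableT_comp mth _.
    exact: measurable_fun_pair.
  - exact: measurableT_comp mFc measurable_fst.
  - apply: measurableT_comp msin _; apply: measurableT_comp mth _.
    exact: measurable_fun_pair.
  - exact: measurableT_comp mFs measurable_fst.
rewrite (@Rintegral_swap _ _ _ _ _ m2 m1 (fun z => w z.1 * f z.2 * H z.2 z.1)
  w (fun x => N1 * `|f x|))//; last 3 first.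
- apply: measurable_funM => //; apply: measurable_funM.
    exact: measurableT_comp mw measurable_fst.
  exact: measurableT_comp mf measurable_snd.
- by apply: eq_integrable (integrableZl measurableT N1 nf_int).
- move=> y x /=; rewrite !normrM (ger0_norm (w_ge0 y)) -mulrA ler_wpM2l//.
  by rewrite mulrC ler_wpM2r.
apply: eq_Rintegral => x _.
(* With [x] now fixed and outermost, [H] is expanded by [HE] and [y] is exchanged with [x']. *)
have mG : measurable_fun [set: Y * X]
    (fun z => w z.1 * (f z.2 * cos (th (x, z.1) - th (z.2, z.1)))).
  apply: measurable_funM; first exact: measurableT_comp mw measurable_fst.
  apply: measurable_funM; first exact: measurableT_comp mf measurable_snd.
  apply: measurableT_comp mcos _; apply: measurable_funB.
    by apply: measurableT_comp mth _; exact: measurable_fun_pair.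
  by apply: measurableT_comp mth _; exact: measurable_fun_pair.
have Gw y x' : `|w y * (f x' * cos (th (x, y) - th (x', y)))| <= w y * `|f x'|.
  by rewrite !normrM (ger0_norm (w_ge0 y)) ler_wpM2l// ler_piMr.
transitivity (f x * \int[m2]_y \int[m1]_x' (w y * (f x' * cos (th (x, y) - th (x', y))))).
  transitivity (f x * \int[m2]_y (w y * H x y)).
    rewrite -RintegralZl//.
      by apply: eq_Rintegral => y _; rewrite mulrCA mulrA.
    apply: (@integrable_dom _ _ _ _ _ (fun y => N1 * w y)).
    - by apply: measurable_funM => //; exact: (measurableT_comp mH (pair2_measurable x)).
    - by apply: eq_integrable (integrableZl measurableT N1 w_int).
    - by move=> y; rewrite normrM (ger0_norm (w_ge0 y)) mulrC ler_wpM2r.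
  congr (_ * _); apply: eq_Rintegral => y _; rewrite HE RintegralZl//.
  apply: intc => //; apply: measurableT_comp mcos _.
  by apply: measurable_funB => //; exact: measurableT_comp mth _.
rewrite (@Rintegral_swap _ _ _ _ _ m2 m1 _ _ _ mG w_int nf_int Gw).
have wcos_int x' : m2.-integrable [set: Y]
   (EFin \o (fun y => w y * cos (th (x, y) - th (x', y)))).
  apply: (integrable_dom _ w_int).
    apply: measurable_funM => //; apply: measurableT_comp mcos _.
    by apply: measurable_funB; exact: measurableT_comp mth _.
  by move=> y; rewrite normrM (ger0_norm (w_ge0 y)) ler_piMr.
transitivity (f x * \int[m1]_x' (f x' * J x x')).
  congr (_ * _); apply: eq_Rintegral => x' _; rewrite -(RintegralZl _ _ (wcos_int x'))//.
  by apply: eq_Rintegral => y _; rewrite mulrCA.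
rewrite -(@RintegralZl _ _ _ _ _ (fun x' => f x' * J x x')) //.
  by apply: eq_Rintegral => x' _; rewrite mulrA.
apply: (@integrable_dom _ _ _ _ _ (fun x' => \int[m2]_y w y * `|f x'|)).
- apply: measurable_funM => //.
  exact: (measurableT_comp mJ (pair1_measurable x)).
- by apply: eq_integrable (integrableZl measurableT _ nf_int).
- move=> x'; rewrite normrM mulrC ler_wpM2r//.
  apply: le_trans (le_normr_Rintegral _ (wcos_int x')) _ => //.
  apply: le_Rintegral => //; first exact: (integrable_abse (wcos_int x')).
  by move=> y _; rewrite normrM (ger0_norm (w_ge0 y)) ler_piMr.
Qed.

(** The same identity in the extended reals and over the product measure, the form in which the
    Schur test bounds it by nonnegative integrands. *)
Lemma integral_quadratic_kernel :
  (\int[m2]_y (w y * (Fc y ^+ 2 + Fs y ^+ 2))%:E =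
   \int[m1 \x m1]_z (f z.1 * f z.2 * J z.1 z.2)%:E)%E.
Proof.
pose g (z : X * X) := f z.1 * f z.2 * J z.1 z.2.
have mg : measurable_fun [set: X * X] g.
  apply: measurable_funM => //; apply: measurable_funM.
    exact: measurableT_comp mf measurable_fst.
  exact: measurableT_comp mf measurable_snd.
have J_le x x' : `|J x x'| <= \int[m2]_y w y.
  have wc : m2.-integrable [set: Y]
      (EFin \o (fun y => w y * cos (th (x, y) - th (x', y)))).
    apply: (integrable_dom _ w_int).
      apply: measurable_funM => //; apply: measurableT_comp mcos _.
      by apply: measurable_funB; exact: measurableT_comp mth _.
    by move=> y; rewrite normrM (ger0_norm (w_ge0 y)) ler_piMr.
  apply: le_trans (le_normr_Rintegral _ wc) _ => //.
  apply: le_Rintegral => //; first exact: (integrable_abse wc).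
  by move=> y _; rewrite normrM (ger0_norm (w_ge0 y)) ler_piMr.
pose a x := \int[m2]_y w y * `|f x|.
have ia : m1.-integrable [set: X] (EFin \o a).
  by apply: eq_integrable (integrableZl measurableT _ nf_int).
have gab x x' : `|g (x, x')| <= a x * `|f x'|.
  by rewrite !normrM /a mulrC -[leRHS]mulrA ler_wpM2r ?mulr_ge0.
have ig := integrable_prod_dom mg ia nf_int gab.
have iwE : m2.-integrable [set: Y] (EFin \o (fun y => w y * (Fc y ^+ 2 + Fs y ^+ 2))).
  apply: (@integrable_dom _ _ _ _ _ (fun y => (2 * N1 ^+ 2) * w y)).
  - apply: measurable_funM => //.
    by apply: measurable_funD; exact: measurable_funX.
  - by apply: eq_integrable (integrableZl measurableT _ w_int).
  - move=> y; rewrite normrM (ger0_norm (w_ge0 y)) mulrC ler_wpM2r//.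
    rewrite ger0_norm ?addr_ge0 ?sqr_ge0// mulr2n mulrDl !mul1r.
    by apply: lerD; rewrite -[X in X <= _]ger0_norm ?sqr_ge0// normrX lerXn2r ?nnegrE//;
      exact: le_norm_int.
transitivity ((\int[m2]_y (w y * (Fc y ^+ 2 + Fs y ^+ 2)))%:E).
  by rewrite fineK//; exact: integrable_fin_num.
rewrite Rintegral_quadratic_kernel.
rewrite -[RHS](integral12_prod_meas1 ig) -[RHS]fineK; last first.
  by rewrite (integral12_prod_meas1 ig); apply: integrable_fin_num.
congr EFin; congr fine; apply: eq_integral => x _.
rewrite /fubini_F fineK//; apply: integrable_fin_num => //.
exact: (integrable_section1 x mg nf_int gab).
Qed.

(* [|f x f x'| <= (f x ^ 2 + f x' ^ 2) / 2] reduces the kernel bound to the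
   row sums of [k] (Schur test). *)
Lemma bessel_le (k : X * X -> R) (b : X -> R) (C : R) : 0 <= C ->
  measurable_fun [set: X * X] k -> measurable_fun [set: X] b ->
  (forall z, 0 <= k z) -> (forall x x', k (x, x') = k (x', x)) ->
  (forall x x', `|J x x'| <= k (x, x')) ->
  (forall x, b x = 1 \/ b x = 0 /\ f x = 0) ->
  (forall x, \int[m1]_x' (b x' * k (x, x'))%:E <= C%:E)%E ->
  (\int[m2]_y (w y * (Fc y ^+ 2 + Fs y ^+ 2))%:E <=
   C%:E * \int[m1]_x (f x ^+ 2)%:E)%E.
Proof.
move=> C0 mk mb k0 ksym Jk hb bkC.
have b0 x : 0 <= b x by case: (hb x) => [->|[->]].
(* [b] is the indicator of a set outside which [f] vanishes, so the majorant may carry it; it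
   confines the row integrals of [k] to that set. The transpose [h'] carries the other square. *)
pose h (z : X * X) := f z.1 ^+ 2 * b z.2 * k z.
have mh : measurable_fun [set: X * X] h.
  apply: measurable_funM => //; apply: measurable_funM.
    apply: measurable_funX; exact: measurableT_comp mf measurable_fst.
  exact: measurableT_comp mb measurable_snd.
have h0 z : 0 <= h z.
  apply: mulr_ge0; last exact: k0.
  by apply: mulr_ge0; [exact: sqr_ge0|exact: b0].
pose h' (z : X * X) := h (z.2, z.1).
have mh' : measurable_fun [set: X * X] h'.
  by apply: measurableT_comp mh _; exact: measurable_fun_pair.
have iterh : (\int[m1 \x m1]_z (h z)%:E <= C%:E * \int[m1]_x (f x ^+ 2)%:E)%E.
  rewrite (@fubini_tonelli1 _ _ _ _ _ m1 m1 (EFin \o h))//; last exact/measurable_EFinP.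
  have mf2 : measurable_fun [set: X] (fun x => (f x ^+ 2)%:E).
    exact/measurable_EFinP/measurable_funX.
  have bk0 x : (0 <= \int[m1]_x' (b x' * k (x, x'))%:E)%E.
    by apply: integral_ge0 => x' _; rewrite lee_fin mulr_ge0.
  apply: (@le_trans _ _ (\int[m1]_x (C%:E * (f x ^+ 2)%:E))%E).
    apply: ge0_le_integral => //.
    - by move=> x _; apply: integral_ge0 => x' _; rewrite lee_fin h0.
    - apply: (@measurable_fun_fubini_tonelli_F _ _ _ _ _ m1 (EFin \o h)) => //.
      exact/measurable_EFinP.
    - by apply: emeasurable_funM.
    - move=> x _; rewrite /fubini_F.
      under eq_integral do rewrite /h /= -mulrA EFinM.
      rewrite ge0_integralZl//; last 3 first.
      + apply/measurable_EFinP; apply: measurable_funM => //.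
        exact: measurableT_comp mk _.
      + by move=> x' _; rewrite lee_fin mulr_ge0.
      + by rewrite lee_fin sqr_ge0.
      rewrite muleC lee_wpmul2r// ?lee_fin ?sqr_ge0//.
  by rewrite ge0_integralZl// => x _; rewrite lee_fin sqr_ge0.
have mhE : measurable_fun [set: X * X] (EFin \o h) by exact/measurable_EFinP.
have mhE' : measurable_fun [set: X * X] (EFin \o h') by exact/measurable_EFinP.
have iterh' : (\int[m1 \x m1]_z (h' z)%:E = \int[m1 \x m1]_z (h z)%:E)%E.
  have h0E z : (0 <= (EFin \o h) z)%E by rewrite lee_fin h0.
  have h0E' z : (0 <= (EFin \o h') z)%E by rewrite lee_fin h0.
  rewrite (@fubini_tonelli2 _ _ _ _ _ m1 m1 _ mhE' h0E').
  by rewrite (@fubini_tonelli1 _ _ _ _ _ m1 m1 _ mhE h0E).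
rewrite integral_quadratic_kernel.
apply: (@le_trans _ _ (\int[m1 \x m1]_z (2^-1%:E * ((h z)%:E + (h' z)%:E)))%E).
  apply: le_trans (lee_abs _) _; apply: le_trans (le_abse_integral _ _ _) _ => //.
    apply/measurable_EFinP; apply: measurable_funM => //; apply: measurable_funM.
      exact: measurableT_comp mf measurable_fst.
    exact: measurableT_comp mf measurable_snd.
  apply: ge0_le_integral => //.
  - apply: measurableT_comp => //.
    apply/measurable_EFinP; apply: measurable_funM => //; apply: measurable_funM.
      exact: measurableT_comp mf measurable_fst.
    exact: measurableT_comp mf measurable_snd.
  - by apply: measurable_funeM; exact: emeasurable_funD.
  - move=> [x x'] _ /=; rewrite -EFinD -EFinM lee_fin /h' /h /= (ksym x' x).
    rewrite normrM; apply: (@le_trans _ _ (`|f x * f x'| * k (x, x'))).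
      by rewrite ler_wpM2l.
    rewrite -mulrDl mulrA ler_wpM2r//.
    have [->|[-> ->]] := hb x; last by rewrite mul0r normr0 expr0n mulr0 mul0r addr0 mulr0.
    have [->|[-> ->]] := hb x'; last by rewrite mulr0 normr0 expr0n mulr0 mul0r addr0 mulr0.
    rewrite normrM -[f x ^+ 2]real_normK ?num_real// -[f x' ^+ 2]real_normK ?num_real//.
    have : 0 <= (`|f x| - `|f x'|) ^+ 2 by exact: sqr_ge0.
    by rewrite sqrrB; lra.
rewrite ge0_integralZl//; last 2 first.
- exact: emeasurable_funD.
- by move=> z _; rewrite adde_ge0 ?lee_fin ?h0.
rewrite ge0_integralD//; last 2 first.
- by move=> z _; rewrite lee_fin h0.
- by move=> z _; rewrite lee_fin h0.
rewrite iterh'; apply: le_trans iterh.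
have : (0 <= \int[m1 \x m1]_z (h z)%:E)%E.
  by apply: integral_ge0 => z _; rewrite lee_fin h0.
case: (\int[m1 \x m1]_z (h z)%:E)%E => [r|//|//] r0.
- by rewrite -EFinD -EFinM lee_fin; lra.
- by rewrite leey.
Qed.

End Bessel.

(** * Plancherel inequality *)

Section Kernel1.
Variable R : realType.
Local Notation M := (measurableTypeR R).
Local Notation mu := (@lebesgue_measure R).

Definition box1 (L t : R) : R := (`|t| <= L)%R%:R.

Lemma box1E L : box1 L = \1_(`[- L, L]%classic : set R).
Proof.
apply/funext => t; rewrite /box1 indicE.
by rewrite mem_setE in_itv/= ler_norml.
Qed.

Lemma box1_ge0 L t : 0 <= box1 L t.
Proof. exact: ler0n. Qed.

Lemma measurable_box1 L : measurable_fun [set: M] (box1 L).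
Proof. by rewrite box1E; apply: measurable_indic; exact: measurable_itv. Qed.

Lemma integral_box1 L : 0 <= L -> (\int[mu]_t (box1 L t)%:E = (2 * L)%:E)%E.
Proof.
move=> L0; rewrite box1E integral_indic ?setIT//.
apply: (etrans (lebesgue_measure_itv _)); rewrite /= lte_fin.
case: ifPn => [_|]; first by rewrite -EFinB opprK mulr2n mulrDl mul1r.
rewrite -leNgt => h; congr EFin; lra.
Qed.

Lemma integrable_box1 L : 0 <= L -> mu.-integrable [set: M] (EFin \o box1 L).
Proof.
move=> L0; apply/integrableP; split; first by apply/measurable_EFinP; exact: measurable_box1.
under eq_integral do rewrite /= ger0_norm ?box1_ge0//.
by rewrite integral_box1// ltry.
Qed.

Lemma integral_itv_box1 (L : R) (f : R -> R) :
  (\int[mu]_(t in `[(- L)%R, L]) (f t)%:E = \int[mu]_t (box1 L t * f t)%:E)%E.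
Proof.
rewrite integral_mkcond; apply: eq_integral => t _.
rewrite patchE box1E indicE; case: ifP => _; rewrite ?mul1r ?mul0r//.
Qed.

Lemma continuous_FTC2_derive (f F : R -> R) (a b : R) : a < b ->
  continuous f -> (forall t : R, is_derive t (1 : R) F (f t)) ->
  (\int[mu]_(t in `[a, b]) (f t)%:E = (F b)%:E - (F a)%:E)%E.
Proof.
move=> ab cf dF.
have cF : continuous F.
  by move=> t; apply/differentiable_continuous/derivable1_diffP; have [] := dF t.
apply: continuous_FTC2 => //.
- exact: continuous_subspaceT.
- split; [by move=> t _; have [] := dF t| |].
  + by apply: cvg_at_right_filter; exact: cF.
  + by apply: cvg_at_left_filter; exact: cF.
- by move=> t _; rewrite derive1E; have [_ ->] := dF t.
Qed.

Variable N : R.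
Hypothesis N0 : 0 < N.

(* Unlike the Fourier transform of the sharp cut-off [box1 N], that of this
   weight is integrable, uniformly in [N]. *)
Definition parab (t : R) : R := box1 N t * (1 - t ^+ 2 / N ^+ 2).

Lemma parab_ge0 t : 0 <= parab t.
Proof.
rewrite /parab /box1; case: (lerP `|t| N) => h; last by rewrite mul0r.
rewrite mul1r subr_ge0 ler_pdivrMr ?exprn_gt0// mul1r -real_normK ?num_real//.
by rewrite lerXn2r// nnegrE// ltW.
Qed.

Lemma parab_le t : parab t <= box1 N t.
Proof.
rewrite /parab ler_piMr ?box1_ge0// lerBlDr lerDl.
by rewrite divr_ge0 ?sqr_ge0.
Qed.

Lemma measurable_parab : measurable_fun [set: M] parab.
Proof.
apply: measurable_funM; first exact: measurable_box1.
apply: measurable_funB => //; apply: measurable_funM => //.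
Qed.

Lemma integrable_parab : mu.-integrable [set: M] (EFin \o parab).
Proof.
apply: (integrable_dom measurable_parab (integrable_box1 (ltW N0))) => t.
by rewrite ger0_norm ?parab_ge0// parab_le.
Qed.

(** Cosine transform of [parab N] in closed form. It decays like [z^-2] because the weight vanishes
    continuously at both ends of its interval. *)
Definition parab_hat (z : R) : R :=
  if z == 0 then 4 * N / 3
  else 4 / (N * z ^+ 2) * (sin (N * z) / (N * z) - cos (N * z)).

(** The weight is even, so the part in [sin A] integrates to 0. The phase [A] is there to hold the
    contribution of other coordinates. *)
Lemma Rintegral_parab_cos (A z : R) :
  \int[mu]_t (parab t * cos (A + z * t)) = cos A * parab_hat z.
Proof.
rewrite /Rintegral; under eq_integral do rewrite /parab -mulrA.
rewrite -(@integral_itv_box1 N (fun t => (1 - t ^+ 2 / N ^+ 2) * cos (A + z * t))).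
have NN : - N < N by rewrite -subr_gt0 opprK addr_gt0.
have N_neq0 : N != 0 by rewrite gt_eqF.
have dlin t : is_derive t (1 : R) (fun t : R => A + z * t) z.
  by apply: is_derive_eq; rewrite /GRing.scale/=; ring.
have dsq t : is_derive t (1 : R) (fun t : R => 1 - t ^+ 2 / N ^+ 2) (- (2 * t / N ^+ 2)).
  by apply: is_derive_eq; rewrite /GRing.scale/=; field.
have dcos t : is_derive t (1 : R) (fun t : R => cos (A + z * t)) (- sin (A + z * t) * z).
  exact: (@is_derive1_comp _ (@cos R)).
have dsin t : is_derive t (1 : R) (fun t : R => sin (A + z * t)) (cos (A + z * t) * z).
  exact: (@is_derive1_comp _ (@sin R)).
have cf : continuous (fun t : R => (1 - t ^+ 2 / N ^+ 2) * cos (A + z * t)).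
  by move=> t; apply/differentiable_continuous/derivable1_diffP.
rewrite /parab_hat; have [z0|z0] := eqVneq z 0.
  have dF t : is_derive t (1 : R) (fun t : R => (t - t ^+ 3 / (3 * N ^+ 2)) * cos A)
     ((1 - t ^+ 2 / N ^+ 2) * cos (A + z * t)).
    by rewrite z0 mul0r addr0; apply: is_derive_eq; rewrite /GRing.scale/=; field.
  rewrite (continuous_FTC2_derive NN cf dF) -EFinB/=; field.
  by [].
(* The primitive obtained by two integrations by parts. *)
pose F (t : R) := (1 - t ^+ 2 / N ^+ 2) * (sin (A + z * t) / z)
   - (2 * t) / (N ^+ 2 * z ^+ 2) * cos (A + z * t)
   + 2 / (N ^+ 2 * z ^+ 3) * sin (A + z * t).
have dF t : is_derive t (1 : R) F ((1 - t ^+ 2 / N ^+ 2) * cos (A + z * t)).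
  apply: is_derive_eq; rewrite /GRing.scale/=; field.
  by rewrite ?z0 ?N_neq0.
rewrite (continuous_FTC2_derive NN cf dF) -EFinB/= /F mulrN (mulrC z N).
rewrite !(sinD, cosD, sinN, cosN); field.
by rewrite ?z0 ?N_neq0.
Qed.

End Kernel1.

Section Kernel3.
Variable R : realType.
Local Notation M := (measurableTypeR R).
Local Notation M3 := (M * M * M)%type.
Local Notation mu := (@lebesgue_measure R).

(** A rescaled Cauchy density: its total mass is [10 * pi] for every [N > 0], which is the
    uniformity that allows [N] to grow. *)
Definition parab_maj (N z : R) : R := 10 * N / (1 + (N * z) ^+ 2).

Lemma parab_maj_ge0 N z : 0 <= N -> 0 <= parab_maj N z.
Proof.
by move=> N0; rewrite /parab_maj divr_ge0 ?mulr_ge0// addr_ge0 ?sqr_ge0.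
Qed.

(** For [|N z| <= 2], the mass of the weight bounds its transform by [2 * N], and [2 * (1 + 4)] is
    the constant 10. Beyond, the closed formula gives [6 * N / (N z)^2], which is smaller than
    needed. *)
Lemma parab_hat_le (N : R) : 0 < N -> forall z, `|parab_hat N z| <= parab_maj N z.
Proof.
move=> N0 z; rewrite /parab_maj ler_pdivlMr ?ltr_pwDl ?sqr_ge0//.
have [u2|u2] := lerP `|N * z| 2.
  have u4 : (N * z) ^+ 2 <= 4.
    by rewrite -real_normK ?num_real// (_ : 4 = 2 ^+ 2) ?lerXn2r ?nnegrE//; ring.
  have h : `|parab_hat N z| <= 2 * N.
    have := Rintegral_parab_cos N0 0 z; rewrite cos0 mul1r => <-.
    have mpc : measurable_fun [set: M] (fun t => parab N t * cos (0 + z * t)).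
      apply: measurable_funM; first exact: measurable_parab.
      apply: continuous_measurable_fun => t.
      apply: (@continuous_comp _ _ _ (fun t => 0 + z * t) (@cos R));
        last exact: continuous_cos.
      by apply: cvgD; [exact: cvg_cst|apply: cvgM; [exact: cvg_cst|exact: cvg_id]].
    have le t : `|parab N t * cos (0 + z * t)| <= box1 N t.
      rewrite normrM (ger0_norm (parab_ge0 N0 t)).
      apply: le_trans (parab_le N t).
      by rewrite ler_piMr ?parab_ge0// ler_norml cos_geN1 cos_le1.
    have ib := integrable_box1 (ltW N0).
    have ipc := integrable_dom mpc ib le.
    apply: le_trans (le_normr_Rintegral _ ipc) _ => //.
    apply: le_trans (le_Rintegral _ (integrable_abse ipc) ib (fun t _ => le t)) _ => //.
    by rewrite /Rintegral integral_box1 ?(ltW N0)/=.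
  apply: (@le_trans _ _ (2 * N * (1 + 4))); last by lra.
  by apply: ler_pM => //; [rewrite addr_ge0 ?sqr_ge0|rewrite lerD2l].
have z0 : z != 0.
  by apply: contraTneq u2 => ->; rewrite mulr0 normr0 -leNgt.
have u0 : 0 < `|N * z| by rewrite (lt_trans _ u2).
rewrite /parab_hat (negbTE z0) normrM.
set u := N * z in u2 u0 *.
have h1 : `|sin u / u - cos u| <= 3 / 2.
  apply: le_trans (ler_normB _ _) _.
  have hc : `|cos u| <= 1 by rewrite ler_norml cos_geN1 cos_le1.
  have hs : `|sin u / u| <= 1 / 2.
    rewrite normrM normfV ler_pdivrMr//.
    apply: (@le_trans _ _ 1); first by rewrite ler_norml sin_geN1 sin_le1.
    by lra.
  by lra.
have h2 : `|4 / (N * z ^+ 2)| = 4 * N / u ^+ 2.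
  rewrite ger0_norm; last by rewrite divr_ge0// mulr_ge0 ?sqr_ge0// ltW.
  by rewrite /u; field; rewrite z0 gt_eqF.
have uu : 4 < u ^+ 2.
  by rewrite -real_normK ?num_real// (_ : 4 = 2 ^+ 2) ?ltrXn2r ?nnegrE//; ring.
rewrite h2; apply: (@le_trans _ _ (4 * N / u ^+ 2 * (3 / 2) * (1 + u ^+ 2))).
  rewrite ler_wpM2r ?addr_ge0 ?sqr_ge0// ler_wpM2l//.
  by rewrite divr_ge0 ?sqr_ge0// mulr_ge0// ltW.
rewrite (_ : _ * _ = (6 * N * (1 + u ^+ 2)) / u ^+ 2); last first.
  by field; rewrite -normr_gt0.
rewrite ler_pdivrMr; last by apply: lt_trans uu.
by nra.
Qed.

Lemma continuous_parab_maj (N : R) : continuous (parab_maj N).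
Proof.
move=> z; apply: cvgM; first exact: cvg_cst.
apply: cvgV; first by rewrite gt_eqF// ltr_pwDl ?sqr_ge0.
apply: cvgD; first exact: cvg_cst.
apply: (@continuous_comp _ _ _ (fun z => N * z) (fun u => u ^+ 2)).
  by apply: cvgM; [exact: cvg_cst|exact: cvg_id].
exact: exprn_continuous.
Qed.

(** The primitive is [-10] times an arctangent, whose variation is at most [pi]. *)
Lemma integral_parab_maj (N L x : R) : 0 < N -> 0 < L ->
  (\int[mu]_y (box1 L y * parab_maj N (x - y))%:E <= (10 * pi)%:E)%E.
Proof.
move=> N0 L0; rewrite -(@integral_itv_box1 _ L (fun y => parab_maj N (x - y))).
have dF y : is_derive y (1 : R) (fun y : R => - (10 : R) * atan (N * (x - y))) (parab_maj N
  (x - y)).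
  have dl : is_derive y (1 : R) (fun y : R => N * (x - y)) (- N).
    by apply: is_derive_eq; rewrite /GRing.scale/=; ring.
  have da : is_derive y (1 : R) (fun y : R => atan (N * (x - y)))
     ((1 + (N * (x - y)) ^+ 2)^-1 * - N).
    exact: (@is_derive1_comp _ (@atan R)).
  by apply: is_derive_eq; rewrite /GRing.scale/= /parab_maj; ring.
rewrite (continuous_FTC2_derive _ _ dF); last 2 first.
- by rewrite -subr_gt0 opprK addr_gt0.
- move=> y; apply: (@continuous_comp _ _ _ (fun y => x - y) (parab_maj N)).
    by apply: cvgB; [exact: cvg_cst|exact: cvg_id].
  exact: continuous_parab_maj.
rewrite -EFinB lee_fin.
have := atan_ltpi2 (N * (x - - L)); have := atan_gtNpi2 (N * (x - L)).
lra.
Qed.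

End Kernel3.

Section Plancherel3.
Variable R : realType.
Local Notation M := (measurableTypeR R).
Local Notation M3 := (M * M * M)%type.
Local Notation mu := (@lebesgue_measure R).

Lemma Rintegral_leb3 (g : M3 -> R) (a b c : M -> R) :
  measurable_fun [set: M3] g -> mu.-integrable [set: M] (EFin \o a) ->
  mu.-integrable [set: M] (EFin \o b) -> mu.-integrable [set: M] (EFin \o c) ->
  (forall x, `|g x| <= a x.1.1 * b x.1.2 * c x.2) ->
  \int[leb3]_x g x = \int[mu]_s \int[mu]_t \int[mu]_u g ((s, t), u).
Proof.
move=> mg ia ib ic gabc.
have ma : measurable_fun [set: M] a by exact/measurable_EFinP/measurable_int/ia.
have mb : measurable_fun [set: M] b by exact/measurable_EFinP/measurable_int/ib.
have mab : measurable_fun [set: M * M] (fun p => a p.1 * b p.2).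
  apply: measurable_funM; first exact: measurableT_comp ma measurable_fst.
  exact: measurableT_comp mb measurable_snd.
have iab : leb2.-integrable [set: M * M] (EFin \o (fun p => a p.1 * b p.2)).
  apply: (@integrable_prod_dom _ _ M M R mu mu _ (fun s => `|a s|) (fun t => `|b t|) mab).
  - exact: integrable_abse ia.
  - exact: integrable_abse ib.
  - by move=> s t; rewrite normrM.
have gab p u : `|g (p, u)| <= a p.1 * b p.2 * c u by exact: gabc.
apply: (etrans (@Rintegral_prod _ _ (M * M)%type M R leb2 mu g _ _ mg iab ic gab)).
have ig := @integrable_prod_dom _ _ (M * M)%type M R leb2 mu g _ _ mg iab ic gab.
have isec p := @integrable_section1 _ _ (M * M)%type M R mu g _ _ p mg ic gab.
have mh : measurable_fun [set: M * M] (fun p => \int[mu]_u g (p, u)).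
  have := measurable_fubini_F ig; rewrite /fubini_F => mF.
  exact: measurableT_comp mF.
apply: (@Rintegral_prod _ _ M M R mu mu _ (fun s => `|a s|)
  (fun t => \int[mu]_u `|c u| * `|b t|) mh).
- exact: integrable_abse ia.
- by apply: eq_integrable (integrableZl measurableT _ (integrable_abse ib)).
- move=> s t; apply: le_trans (le_normr_Rintegral _ (isec (s, t))) _ => //.
  rewrite [leRHS](_ : _ = `|a s * b t| * \int[mu]_u `|c u|); last first.
    by rewrite normrM; ring.
  rewrite -RintegralZl//; last exact: integrable_abse ic.
  apply: le_Rintegral => //.
  - exact: integrable_abse (isec (s, t)).
  - by apply: eq_integrable (integrableZl measurableT _ (integrable_abse ic)).
  - by move=> u _; rewrite -normrM (le_trans (gab (s, t) u))// ler_norm.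
Qed.

Definition box3 (L : R) (x : M3) : R := box1 L x.1.1 * box1 L x.1.2 * box1 L x.2.

Definition parab3 (N : R) (x : M3) : R := parab N x.1.1 * parab N x.1.2 * parab N x.2.

Lemma measurable_prod3 (a b c : M -> R) : measurable_fun [set: M] a ->
  measurable_fun [set: M] b -> measurable_fun [set: M] c ->
  measurable_fun [set: M3] (fun x => a x.1.1 * b x.1.2 * c x.2).
Proof.
move=> ma mb mc; apply: measurable_funM; [apply: measurable_funM|].
- by apply: measurableT_comp ma _; exact: measurableT_comp measurable_fst measurable_fst.
- by apply: measurableT_comp mb _; exact: measurableT_comp measurable_snd measurable_fst.
- exact: measurableT_comp mc measurable_snd.
Qed.

Lemma measurable_box3 L : measurable_fun [set: M3] (box3 L).
Proof. by apply: measurable_prod3; exact: measurable_box1. Qed.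

Lemma measurable_parab3 N : measurable_fun [set: M3] (parab3 N).
Proof. by apply: measurable_prod3; exact: measurable_parab. Qed.

Lemma box3_ge0 L x : 0 <= box3 L x.
Proof. by rewrite !mulr_ge0// box1_ge0. Qed.

Lemma box3_01 L x : box3 L x = 1 \/ box3 L x = 0.
Proof.
rewrite /box3 /box1; case: (_ <= L); case: (_ <= L); case: (_ <= L);
  rewrite ?mulr0 ?mul0r ?mulr1; by [left|right].
Qed.

Lemma parab3_ge0 N x : 0 < N -> 0 <= parab3 N x.
Proof.
by move=> N0; apply: mulr_ge0; [apply: mulr_ge0|]; exact: parab_ge0.
Qed.

Lemma integral_box3 L : 0 <= L -> (\int[leb3]_x (box3 L x)%:E = ((2 * L) ^+ 3)%:E)%E.
Proof.
move=> L0.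
apply: (etrans (integral_leb3_prod (@measurable_box1 R L) (@measurable_box1 R L)
  (@measurable_box1 R L) (box1_ge0 L) (box1_ge0 L) (box1_ge0 L))).
by rewrite integral_box1// -!EFinM; congr EFin; ring.
Qed.

Lemma integrable_box3 L : 0 <= L -> leb3.-integrable [set: M3] (EFin \o box3 L).
Proof.
move=> L0; apply/integrableP; split.
  by apply/measurable_EFinP; exact: measurable_box3.
under eq_integral do rewrite /= ger0_norm ?box3_ge0//.
by rewrite integral_box3// ltry.
Qed.

Lemma integrable_bounded (f : M3 -> R) (B L : R) : 0 <= L ->
  measurable_fun [set: M3] f -> (forall x, `|f x| <= B * box3 L x) ->
  leb3.-integrable [set: M3] (EFin \o f).
Proof.
move=> L0 mf fB; apply: (integrable_dom mf _ fB).
by apply: eq_integrable (integrableZl measurableT B (integrable_box3 L0)).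
Qed.

Lemma integrable_parab3 N : 0 < N -> leb3.-integrable [set: M3] (EFin \o parab3 N).
Proof.
move=> N0; apply: (@integrable_bounded _ 1 N (ltW N0)); first exact: measurable_parab3.
move=> x; rewrite mul1r ger0_norm ?parab3_ge0// /parab3 /box3.
apply: ler_pM; [|exact: parab_ge0| |exact: parab_le].
  by apply: mulr_ge0; exact: parab_ge0.
by apply: ler_pM; [exact: parab_ge0|exact: parab_ge0|exact: parab_le|exact: parab_le].
Qed.

Lemma measurable_dot3 d (T : measurableType d) (f g : T -> M3) :
  measurable_fun [set: T] f -> measurable_fun [set: T] g ->
  measurable_fun [set: T] (fun x => dot3 (f x) (g x)).
Proof.
move=> mf mg.
have m11 : measurable_fun [set: M3] (fun x : M3 => x.1.1).
  exact: measurableT_comp measurable_fst measurable_fst.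
have m12 : measurable_fun [set: M3] (fun x : M3 => x.1.2).
  exact: measurableT_comp measurable_snd measurable_fst.
have m2 : measurable_fun [set: M3] (fun x : M3 => x.2) by exact: measurable_snd.
apply: measurable_funD; [apply: measurable_funD|]; apply: measurable_funM.
- exact: measurableT_comp m11 mf.
- exact: measurableT_comp m11 mg.
- exact: measurableT_comp m12 mf.
- exact: measurableT_comp m12 mg.
- exact: measurableT_comp m2 mf.
- exact: measurableT_comp m2 mg.
Qed.

Lemma measurable_cos : measurable_fun [set: R] (@cos R).
Proof. by apply: continuous_measurable_fun; exact: continuous_cos. Qed.

Lemma integrable_parab_cos (N A z : R) : 0 < N ->
  mu.-integrable [set: M] (EFin \o (fun t => parab N t * cos (A + z * t))).
Proof.
move=> N0; apply: (integrable_dom _ (integrable_parab N0)).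
  apply: measurable_funM; first exact: measurable_parab.
  by apply: measurableT_comp measurable_cos _; apply: measurable_funD => //;
    exact: measurable_funM.
move=> t; rewrite normrM ger0_norm ?parab_ge0// ler_piMr ?parab_ge0//.
by rewrite ler_norml cos_geN1 cos_le1.
Qed.

(** The weight is a product, so the coordinates are integrated one at a time, the remaining ones
    entering through the phase; the last phase is 0, whence [cos 0 = 1]. *)
Lemma Rintegral_parab3_cos (N : R) (x x' : M3) : 0 < N ->
  \int[leb3]_y (parab3 N y * cos (dot3 x y - dot3 x' y)) =
  parab_hat N (x.1.1 - x'.1.1) * parab_hat N (x.1.2 - x'.1.2) *
  parab_hat N (x.2 - x'.2).
Proof.
move=> N0; have ip := integrable_parab N0.
have icos A z : mu.-integrable [set: M] (EFin \o (fun t => parab N t * cos (A + z * t))).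
  exact: integrable_parab_cos.
rewrite (@Rintegral_leb3 _ (parab N) (parab N) (parab N))//; last 2 first.
- apply: measurable_funM; first exact: measurable_parab3.
  apply: measurableT_comp measurable_cos _.
  by apply: measurable_funB; exact: measurable_dot3.
- move=> y; rewrite normrM ger0_norm ?parab3_ge0// ler_piMr ?parab3_ge0//.
  by rewrite ler_norml cos_geN1 cos_le1.
pose z1 := x.1.1 - x'.1.1; pose z2 := x.1.2 - x'.1.2; pose z3 := x.2 - x'.2.
transitivity (\int[mu]_s \int[mu]_t
    (parab N s * parab_hat N z3 * (parab N t * cos (z1 * s + z2 * t)))).
  apply: eq_Rintegral => s _; apply: eq_Rintegral => t _.
  transitivity (\int[mu]_u (parab N s * parab N t * (parab N u * cos ((z1 * s + z2 * t) + z3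
    * u)))).
    apply: eq_Rintegral => u _; rewrite /parab3/= mulrA; congr (_ * cos _).
    by rewrite /dot3/= /z1 /z2 /z3; ring.
  by rewrite RintegralZl// Rintegral_parab_cos//; ring.
transitivity (\int[mu]_s (parab_hat N z3 * parab_hat N z2 * (parab N s * cos (0 + z1 * s)))).
  apply: eq_Rintegral => s _; rewrite RintegralZl// Rintegral_parab_cos// add0r.
  ring.
by rewrite RintegralZl// Rintegral_parab_cos// cos0 /z1 /z2 /z3; ring.
Qed.

Definition fcos (f : M3 -> R) (y : M3) : R := \int[leb3]_x (f x * cos (dot3 x y)).
Definition fsin (f : M3 -> R) (y : M3) : R := \int[leb3]_x (f x * sin (dot3 x y)).

Section bounded.
Variables (f : M3 -> R) (B L : R).
Hypotheses (L0 : 0 < L) (mf : measurable_fun [set: M3] f).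
Hypothesis fB : forall x, `|f x| <= B * box3 L x.

(** The Schur test with a kernel that splits into one-dimensional majorants: the row integral over
    the box is at most [10 * pi] per coordinate, whatever [N] and [L]. *)
Lemma parab3_plancherel_le (N : R) : 0 < N ->
  (\int[leb3]_y (parab3 N y * (fcos f y ^+ 2 + fsin f y ^+ 2))%:E <=
   ((10 * pi) ^+ 3)%:E * \int[leb3]_x (f x ^+ 2)%:E)%E.
Proof.
move=> N0; have pi0 := pi_ge0 R.
pose k (z : M3 * M3) := parab_maj N (z.1.1.1 - z.2.1.1) *
  parab_maj N (z.1.1.2 - z.2.1.2) * parab_maj N (z.1.2 - z.2.2).
have mpm : measurable_fun [set: R] (parab_maj N).
  by apply: continuous_measurable_fun => t; exact: continuous_parab_maj.
have m11 : measurable_fun [set: M3] (fun x : M3 => x.1.1).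
  exact: measurableT_comp measurable_fst measurable_fst.
have m12 : measurable_fun [set: M3] (fun x : M3 => x.1.2).
  exact: measurableT_comp measurable_snd measurable_fst.
have m2 : measurable_fun [set: M3] (fun x : M3 => x.2) by exact: measurable_snd.
have k0 z : 0 <= k z.
  by apply: mulr_ge0; [apply: mulr_ge0|]; apply: parab_maj_ge0; exact: ltW.
have majN t : parab_maj N (- t) = parab_maj N t by rewrite /parab_maj mulrN sqrrN.
apply: (@bessel_le _ _ M3 M3 R leb3 leb3 f (parab3 N) (fun z => dot3 z.1 z.2)
  (integrable_bounded (ltW L0) mf fB) (integrable_parab3 N0)
  (fun y => parab3_ge0 y N0) _ k (box3 L)).
- by apply: measurable_dot3; [exact: measurable_fst|exact: measurable_snd].
- by rewrite exprn_ge0// mulr_ge0.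
- apply: measurable_funM; [apply: measurable_funM|].
  + by apply: measurableT_comp mpm _; apply: measurable_funB;
      [exact: measurableT_comp m11 measurable_fst|exact: measurableT_comp m11 measurable_snd].
  + by apply: measurableT_comp mpm _; apply: measurable_funB;
      [exact: measurableT_comp m12 measurable_fst|exact: measurableT_comp m12 measurable_snd].
  + by apply: measurableT_comp mpm _; apply: measurable_funB;
      [exact: measurableT_comp m2 measurable_fst|exact: measurableT_comp m2 measurable_snd].
- exact: measurable_box3.
- exact: k0.
- by move=> x x'; rewrite /k /=; congr (_ * _ * _); rewrite -majN opprB.
- move=> x x' /=; rewrite Rintegral_parab3_cos// !normrM.
  apply: ler_pM; rewrite ?mulr_ge0//; last exact: parab_hat_le.
  by apply: ler_pM => //; exact: parab_hat_le.
- move=> x; have [|b0] := box3_01 L x; [by left|right; split=> //].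
  by apply/eqP; rewrite -normr_le0 (le_trans (fB x))// b0 mulr0.
- move=> x.
  pose c (a t : R) := box1 L t * parab_maj N (a - t).
  have mc a : measurable_fun [set: M] (c a).
    apply: measurable_funM; first exact: measurable_box1.
    by apply: measurableT_comp mpm _; apply: measurable_funB.
  have c0 a t : 0 <= c a t.
    by apply: mulr_ge0; [exact: box1_ge0|exact/parab_maj_ge0/ltW].
  rewrite [leLHS](_ : _ = \int[leb3]_x' (c x.1.1 x'.1.1 * c x.1.2 x'.1.2 * c x.2 x'.2)%:E)%E;
    last first.
    by apply: eq_integral => x' _; congr EFin; rewrite /k /c /box3/=; ring.
  rewrite (integral_leb3_prod (mc _) (mc _) (mc _) (c0 _) (c0 _) (c0 _)).
  have c1 a := @integral_parab_maj R N L a N0 L0.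
  have ci0 a : (0 <= \int[mu]_t (c a t)%:E)%E.
    by apply: integral_ge0 => t _; rewrite lee_fin.
  rewrite (_ : ((10 * pi) ^+ 3)%:E = (10 * pi)%:E * (10 * pi)%:E * (10 * pi)%:E)%E; last first.
    by rewrite -!EFinM; congr EFin; ring.
  apply: lee_pmul; [by apply: mule_ge0|exact: ci0| |exact: c1].
  by apply: lee_pmul; [exact: ci0|exact: ci0|exact: c1|exact: c1].
Qed.

Lemma measurable_fcos_fsin :
  measurable_fun [set: M3] (fun y => fcos f y ^+ 2 + fsin f y ^+ 2).
Proof.
have nf := integrable_abse (integrable_bounded (ltW L0) mf fB).
have msin : measurable_fun [set: R] (@sin R).
  by apply: continuous_measurable_fun; exact: continuous_sin.
have md : measurable_fun [set: M3 * M3] (fun z => dot3 z.2 z.1).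
  by apply: measurable_dot3; [exact: measurable_snd|exact: measurable_fst].
have mf2 : measurable_fun [set: M3 * M3] (fun z => f z.2).
  exact: measurableT_comp mf measurable_snd.
apply: measurable_funD; apply: measurable_funX.
- apply: (@measurable_Rintegral _ _ M3 M3 R leb3 (fun z => f z.2 * cos (dot3 z.2 z.1)) _ _ nf).
    by apply: measurable_funM => //; exact: measurableT_comp measurable_cos md.
  by move=> x y /=; rewrite normrM ler_piMr// ler_norml cos_geN1 cos_le1.
- apply: (@measurable_Rintegral _ _ M3 M3 R leb3 (fun z => f z.2 * sin (dot3 z.2 z.1)) _ _ nf).
    by apply: measurable_funM => //; exact: measurableT_comp msin md.
  by move=> x y /=; rewrite normrM ler_piMr// ler_norml sin_geN1 sin_le1.
Qed.

(** The weight [parab3 N] increases to 1 with [N], so monotone convergence removes it. The indices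
    are [n.+1] because the cut-off has to be positive. *)
Lemma plancherel_le :
  (\int[leb3]_y (fcos f y ^+ 2 + fsin f y ^+ 2)%:E <=
   ((10 * pi) ^+ 3)%:E * \int[leb3]_x (f x ^+ 2)%:E)%E.
Proof.
pose E y := fcos f y ^+ 2 + fsin f y ^+ 2.
have E0 y : 0 <= E y by rewrite addr_ge0 ?sqr_ge0.
pose g n (y : M3) := parab3 n.+1%:R y * E y.
have nS n : 0 < n.+1%:R :> R by rewrite ltr0Sn.
have parab_nd (t : R) m n : (m <= n)%N -> parab m.+1%:R t <= parab n.+1%:R t.
  move=> mn; have mnR : m.+1%:R <= n.+1%:R :> R by rewrite ler_nat.
  rewrite {1}/parab {1}/box1; case: (lerP `|t| m.+1%:R) => tm; last first.
    by rewrite mul0r parab_ge0.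
  rewrite mul1r /parab /box1 (le_trans tm mnR) mul1r lerD2l lerN2.
  by rewrite ler_wpM2l ?sqr_ge0// lef_pV2 ?posrE ?exprn_gt0// lerXn2r ?nnegrE.
have parab_cvg (t : R) : parab n.+1%:R t @[n --> \oo] --> (1 : R).
  have : (1 - t ^+ 2 * (n.+1%:R^-1 * n.+1%:R^-1)) @[n --> \oo] --> (1 - t ^+ 2 * (0 * 0) : R).
    apply: cvgB; first exact: cvg_cst.
    apply: cvgM; first exact: cvg_cst.
    by apply: cvgM; exact: cvg_harmonic.
  rewrite !mulr0 subr0; apply: cvg_trans; apply: near_eq_cvg; near=> n.
  rewrite /parab /box1 (_ : `|t| <= n.+1%:R) ?mul1r.
    by rewrite expr2 [n.+1%:R ^+ 2]expr2 invfM.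
  have : `|t| <= n%:R by near: n; exact: nbhs_infty_ger.
  by move=> /le_trans -> //; rewrite ler_nat.
have mg n : measurable_fun [set: M3] (EFin \o g n).
  apply/measurable_EFinP; apply: measurable_funM; first exact: measurable_parab3.
  exact: measurable_fcos_fsin.
have g0 n y : (0 <= (g n y)%:E)%E by rewrite lee_fin mulr_ge0// parab3_ge0.
have g_nd m n y : (m <= n)%N -> ((g m y)%:E <= (g n y)%:E)%E.
  move=> mn; rewrite lee_fin ler_wpM2r//.
  apply: ler_pM; [|exact: parab_ge0| |exact: parab_nd].
    by apply: mulr_ge0; exact: parab_ge0.
  by apply: ler_pM; [exact: parab_ge0|exact: parab_ge0|exact: parab_nd|exact: parab_nd].
have g_cvg y : (EFin \o g ^~ y) n @[n --> \oo] --> (E y)%:E.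
  apply: cvg_EFin; first by near=> n.
  rewrite -[E y]mul1r; apply: cvgM; last exact: cvg_cst.
  have := cvgM (cvgM (parab_cvg y.1.1) (parab_cvg y.1.2)) (parab_cvg y.2).
  by rewrite !mulr1; apply.
rewrite (_ : (fun y => _) = (fun y => limn (fun n => (g n y)%:E))); last first.
  by apply/funext => y; apply/esym/cvg_lim => //; exact: g_cvg.
rewrite monotone_convergence; last first.
- by move=> y _ m n mn; exact: g_nd.
- by move=> n y _; exact: g0.
- exact: mg.
- by [].
apply: lime_le; last by near=> n; exact: parab3_plancherel_le.
apply: ereal_nondecreasing_is_cvgn => m n mn.
apply: ge0_le_integral => //.
- exact: mg.
- exact: mg.
- by move=> y _; exact: g_nd.
Unshelve. all: by end_near. Qed.

End bounded.

End Plancherel3.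

(** * The smoothed shell *)

Section Profile.
Variable R : realType.
Local Notation M := (measurableTypeR R).
Local Notation M3 := (M * M * M)%type.
Local Notation mu := (@lebesgue_measure R).

(** Integration by parts without boundary terms, to be applied with [h] a product. *)
Lemma Rintegral_derive_eq0 (h h' : R -> R) (L : R) : 0 < L ->
  (forall t, is_derive t (1 : R) h (h' t)) -> continuous h' ->
  (forall t, L <= `|t| -> h t = 0) -> (forall t, L <= `|t| -> h' t = 0) ->
  \int[mu]_t h' t = 0.
Proof.
move=> L0 dh ch' h0 h'0; rewrite /Rintegral.
rewrite (_ : (fun x => _) = (fun t => (box1 L t * h' t)%:E)); last first.
  apply/funext => t; congr EFin; rewrite /box1.
  by case: (lerP `|t| L) => [_|/ltW/h'0 ->]; rewrite ?mul1r ?mulr0.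
rewrite -integral_itv_box1 (continuous_FTC2_derive _ ch' dh); last first.
  by rewrite -subr_gt0 opprK addr_gt0.
by rewrite !h0 ?sube0// ?normrN ger0_norm// ltW.
Qed.

(** The range [t <= 1] is that of the argument [1 - thick u ^+ 2] in the profile; there [C * t ^+ 2]
    is at most [C] for [t > 0]. *)
Lemma flat_deriv_bounded : exists2 C : R, 0 <= C &
  forall t, t <= 1 -> `|flat (flat_deriv 1) t| <= C.
Proof.
have [C C0 hC] := @flat_bound R (flat_deriv 1); exists C => // t t1.
have [t0|t0] := lerP t 0; first by rewrite /flat ltNge t0/= normr0.
apply: le_trans (hC t) _; rewrite ler_piMr// -(expr1n _ 2).
by rewrite lerXn2r// ?nnegrE// ltW.
Qed.

Variables (S lam amp : R).
Hypotheses (S_gt0 : 0 < S) (Slam : 4 * S <= lam) (amp_gt0 : 0 < amp).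

Let lam_gt0 : 0 < lam. Proof. by apply: lt_le_trans Slam; rewrite mulr_gt0. Qed.
Let lamS_gt0 : 0 < lam * S. Proof. exact: mulr_gt0. Qed.

(** The variable is [u = |x|^2], which is polynomial in the coordinates, so that the origin needs no
    special care. The condition [|thick u| <= 1] forces [|x|] to be within [S] of [lam]. *)
Definition thick (u : R) : R := (u - lam ^+ 2) / (lam * S).

Definition prof (u : R) : R := amp * flat 1 (1 - thick u ^+ 2).

Definition dprof (u : R) : R :=
  amp * (flat (flat_deriv 1) (1 - thick u ^+ 2) * (- (2 * thick u / (lam * S)))).

Definition bump (x : M3) : R := prof (dot3 x x).

Definition shell (x : M3) : R := (`|thick (dot3 x x)| <= 1)%R%:R.

Lemma prof_ge0 u : 0 <= prof u.
Proof. by rewrite mulr_ge0 ?flat1_ge0// ltW. Qed.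

Lemma flat_thick_eq0 P u : 1 < `|thick u| -> flat P (1 - thick u ^+ 2) = 0.
Proof.
move=> u1; rewrite /flat ltNge subr_le0 (_ : 1 <= _)//.
by rewrite -real_normK ?num_real// -(expr1n _ 2) lerXn2r ?nnegrE// ltW.
Qed.

Lemma is_derive_prof u : is_derive u (1 : R) prof (dprof u).
Proof.
have dw : is_derive u (1 : R) (fun u : R => 1 - thick u ^+ 2) (- (2 * thick u / (lam * S))).
  rewrite /thick; apply: is_derive_eq; rewrite /GRing.scale/=; field.
  by rewrite !gt_eqF.
have df : is_derive u (1 : R) (fun u : R => flat 1 (1 - thick u ^+ 2))
    (flat (flat_deriv 1) (1 - thick u ^+ 2) * (- (2 * thick u / (lam * S)))).
  exact: (@is_derive1_comp _ (flat 1) _ _ _ _ (is_derive_flat _ _)).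
exact: is_deriveZ.
Qed.

Lemma derivable_dprof u : derivable dprof u (1 : R).
Proof.
have dw : is_derive u (1 : R) (fun u : R => 1 - thick u ^+ 2) (- (2 * thick u / (lam * S))).
  rewrite /thick; apply: is_derive_eq; rewrite /GRing.scale/=; field.
  by rewrite !gt_eqF.
have df : is_derive u (1 : R) (fun u : R => flat (flat_deriv 1) (1 - thick u ^+ 2))
    (flat (flat_deriv (flat_deriv 1)) (1 - thick u ^+ 2) * (- (2 * thick u / (lam * S)))).
  exact: (@is_derive1_comp _ (flat (flat_deriv 1)) _ _ _ _ (is_derive_flat _ _)).
have dt : is_derive u (1 : R) (fun u : R => - (2 * thick u / (lam * S)))
    (- (2 / (lam * S) / (lam * S))).
  rewrite /thick; apply: is_derive_eq; rewrite /GRing.scale/=; field.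
  by rewrite !gt_eqF.
exact: derivableM.
Qed.

Lemma continuous_prof : continuous prof.
Proof.
by move=> u; apply/differentiable_continuous/derivable1_diffP; have [] := is_derive_prof u.
Qed.

Lemma continuous_dprof : continuous dprof.
Proof.
by move=> u; apply/differentiable_continuous/derivable1_diffP; exact: derivable_dprof.
Qed.

Lemma prof_le u : prof u <= amp.
Proof. by rewrite ler_piMr ?flat1_le1// ltW. Qed.

(** The threshold is the square of [3 / 2 * lam], the half-side of the box that contains the
    shell. *)
Lemma thick_gt1 u : 9 / 4 * lam ^+ 2 <= u -> 1 < `|thick u|.
Proof.
move=> h; have l0 := lam_gt0; have ls0 := lamS_gt0.
have h1 : lam * S < u - lam ^+ 2.
  apply: (@lt_le_trans _ _ (5 / 4 * lam ^+ 2)); last by lra.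
  have : lam * (4 * S) <= lam * lam by rewrite ler_pM2l.
  have : 0 < lam * lam by rewrite mulr_gt0.
  by rewrite expr2; lra.
rewrite /thick ger0_norm; last by rewrite divr_ge0// ltW// (lt_trans lamS_gt0).
by rewrite ltr_pdivlMr// mul1r.
Qed.

Lemma prof_eq0 u : 1 < `|thick u| -> prof u = 0.
Proof. by move=> h; rewrite /prof flat_thick_eq0// mulr0. Qed.

Lemma dprof_eq0 u : 1 < `|thick u| -> dprof u = 0.
Proof. by move=> h; rewrite /dprof flat_thick_eq0// mul0r mulr0. Qed.

Lemma dprof_le C u : 0 <= C ->
  (forall t, t <= 1 -> `|flat (flat_deriv 1) t| <= C) ->
  `|dprof u| <= amp * (2 * C / (lam * S)).
Proof.
move=> C0 hC; rewrite /dprof; have [u1|u1] := lerP `|thick u| 1; last first.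
  rewrite flat_thick_eq0// mul0r mulr0 normr0 mulr_ge0 ?(ltW amp_gt0)//.
  by rewrite divr_ge0 ?(ltW lamS_gt0)// mulr_ge0.
rewrite normrM (ger0_norm (ltW amp_gt0)) ler_wpM2l ?(ltW amp_gt0)// normrM normrN.
rewrite normrM normfV (ger0_norm (ltW lamS_gt0)) normrM (ger0_norm (ler0n _ 2)).
rewrite mulrA ler_wpM2r ?invr_ge0 ?(ltW lamS_gt0)//.
rewrite [leRHS]mulrC; apply: ler_pM => //; last by rewrite ler_piMr.
by apply: hC; rewrite lerBlDr lerDl sqr_ge0.
Qed.

Lemma shell_box3 x : shell x <= box3 (3 / 2 * lam) x.
Proof.
rewrite /shell; case: (lerP `|thick _| 1) => [h|_]; last exact: box3_ge0.
have l0 := lam_gt0.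
have hu : dot3 x x < 9 / 4 * lam ^+ 2.
  by rewrite ltNge; apply/negP => /thick_gt1; rewrite ltNge h.
have sq0 (a b c : R) : a ^+ 2 + b ^+ 2 + c ^+ 2 < 9 / 4 * lam ^+ 2 -> `|a| <= 3 / 2 * lam.
  move=> H; rewrite -(@ler_pXn2r _ 2)// ?nnegrE// ?mulr_ge0 ?ltW//.
  rewrite real_normK ?num_real//.
  have := sqr_ge0 b; have := sqr_ge0 c.
  by rewrite exprMn (_ : (3 / 2) ^+ 2 = 9 / 4 :> R); [lra|field].
rewrite /box3 /box1 (sq0 _ x.1.2 x.2) ?(sq0 x.1.2 x.1.1 x.2) ?(sq0 x.2 x.1.1 x.1.2) ?mulr1//;
 by apply: le_lt_trans hu; rewrite /dot3 -!expr2; lra.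
Qed.

Lemma measurable_comp_sqr (g : R -> R) : continuous g ->
  measurable_fun [set: M3] (fun x => g (dot3 x x)).
Proof.
move=> cg; apply: (@measurableT_comp _ _ _ _ _ _ g).
  by apply: continuous_measurable_fun => t; exact: cg.
exact: measurable_dot3.
Qed.

Lemma continuous_thick : continuous thick.
Proof.
move=> u; apply: cvgM; last exact: cvg_cst.
by apply: cvgB; [exact: cvg_id|exact: cvg_cst].
Qed.

Lemma measurable_shell : measurable_fun [set: M3] shell.
Proof.
have -> : shell = box1 1 \o (fun x : M3 => thick (dot3 x x)) by [].
apply: measurableT_comp; first exact: measurable_box1.
by apply: (@measurable_comp_sqr thick) => t; exact: continuous_thick.
Qed.

Lemma shell_01 x : shell x = 1 \/ shell x = 0.
Proof. by rewrite /shell; case: (_ <= 1); [left|right]. Qed.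

Lemma shell_ge0 x : 0 <= shell x. Proof. exact: ler0n. Qed.

Lemma bump_le x : `|bump x| <= amp * shell x.
Proof.
rewrite /bump /shell; have [h|h] := lerP `|thick _| 1.
  by rewrite mulr1 ger0_norm ?prof_ge0// prof_le.
by rewrite prof_eq0// normr0 mulr0.
Qed.

(** Partial derivative of [bump] in the third coordinate; the two others are reduced to it by
    permuting the coordinates. *)
Definition dbump (x : M3) : R := 2 * x.2 * dprof (dot3 x x).

(** The factor [lam] from [|x.2|] cancels the [1 / lam] in the slope of [thick]. What is left,
    [amp / S], is the natural size of the gradient across a layer of thickness [S]. *)
Lemma dbump_le C x : 0 <= C ->
  (forall t, t <= 1 -> `|flat (flat_deriv 1) t| <= C) ->
  `|dbump x| <= 6 * C * amp / S * shell x.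
Proof.
move=> C0 hC; have := shell_box3 x; rewrite /dbump /shell.
have [h|h] := lerP `|thick _| 1; last by rewrite dprof_eq0// !mulr0 normr0.
rewrite mulr1 /box3 /box1 => hb.
have x2 : `|x.2| <= 3 / 2 * lam.
  by move: hb; case: (lerP `|x.2| _) => //; rewrite mulr0 ler10.
rewrite normrM normrM (ger0_norm (ler0n _ 2)).
apply: (@le_trans _ _ (2 * (3 / 2 * lam) * (amp * (2 * C / (lam * S))))).
  by apply: ler_pM; rewrite ?mulr_ge0//; [rewrite ler_wpM2l|exact: dprof_le].
by rewrite le_eqVlt; apply/orP; left; apply/eqP; field; rewrite !gt_eqF.
Qed.

Lemma measurable_bump : measurable_fun [set: M3] bump.
Proof. by apply: (@measurable_comp_sqr prof) => t; exact: continuous_prof. Qed.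

Lemma measurable_dbump : measurable_fun [set: M3] dbump.
Proof.
apply: measurable_funM; first exact: measurable_funM.
by apply: (@measurable_comp_sqr dprof) => t; exact: continuous_dprof.
Qed.

Let L : R := 3 / 2 * lam.
Let L_gt0 : 0 < L. Proof. by rewrite mulr_gt0. Qed.

Lemma bump_box3 x : `|bump x| <= amp * box3 L x.
Proof. by apply: le_trans (bump_le x) _; rewrite ler_wpM2l ?(ltW amp_gt0) ?shell_box3. Qed.

Lemma dbump_box3 C x : 0 <= C ->
  (forall t, t <= 1 -> `|flat (flat_deriv 1) t| <= C) ->
  `|dbump x| <= 6 * C * amp / S * box3 L x.
Proof.
move=> C0 hC; apply: le_trans (dbump_le x C0 hC) _; rewrite ler_wpM2l ?shell_box3//.
by rewrite divr_ge0 ?(ltW S_gt0)// !mulr_ge0// ltW.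
Qed.

(** Integration by parts in the third coordinate, for [cos] and [sin] at once. On each vertical line
    the difference of the two integrands is the derivative of [prof * c], which vanishes outside the
    box. *)
Lemma Rintegral_dbump (c c' : R -> R) (y : M3) :
  (forall t, is_derive t (1 : R) c (c' t)) -> continuous c' ->
  (forall t, `|c t| <= 1) -> (forall t, `|c' t| <= 1) ->
  \int[leb3]_x (dbump x * c (dot3 x y)) =
  - y.2 * \int[leb3]_x (bump x * c' (dot3 x y)).
Proof.
move=> dc cc' c1 c'1; have [C C0 hC] := flat_deriv_bounded.
have cc : continuous c.
  by move=> t; apply/differentiable_continuous/derivable1_diffP; have [] := dc t.
have mc : measurable_fun [set: M3] (fun x => c (dot3 x y)).
  apply: (@measurableT_comp _ _ _ _ _ _ c); last exact: measurable_dot3.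
  by apply: continuous_measurable_fun => t; exact: cc.
have mc' : measurable_fun [set: M3] (fun x => c' (dot3 x y)).
  apply: (@measurableT_comp _ _ _ _ _ _ c'); last exact: measurable_dot3.
  by apply: continuous_measurable_fun => t; exact: cc'.
have m1 := measurable_funM measurable_dbump mc.
have m2 := measurable_funM measurable_bump mc'.
have b1 x : `|dbump x * c (dot3 x y)| <= 6 * C * amp / S * box3 L x.
  by rewrite normrM (le_trans _ (dbump_box3 x C0 hC))// ler_piMr.
have b2 x : `|bump x * c' (dot3 x y)| <= amp * box3 L x.
  by rewrite normrM (le_trans _ (bump_box3 x))// ler_piMr.
have i1 := integrable_bounded (ltW L_gt0) m1 b1.
have i2 := integrable_bounded (ltW L_gt0) m2 b2.
rewrite -RintegralZl//; apply/eqP; rewrite -subr_eq0 -RintegralB//; last first.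
  by apply: eq_integrable (integrableZl measurableT _ i2).
pose B := 6 * C * amp / S + `|y.2| * amp.
rewrite (@Rintegral_leb3 _ _ (fun s => B * box1 L s) (box1 L) (box1 L)); last 5 first.
- apply: measurable_funB => //; exact: measurable_funM.
- by apply: eq_integrable (integrableZl measurableT _ (integrable_box1 (ltW L_gt0))).
- exact/integrable_box1/ltW.
- exact/integrable_box1/ltW.
- move=> x; rewrite (_ : _ * box1 L x.2 = B * box3 L x); last first.
    by rewrite /box3 !mulrA.
  apply: le_trans (ler_normB _ _) _; rewrite [leRHS]mulrDl; apply: lerD; first exact: b1.
  by rewrite normrM normrN -[leRHS]mulrA; apply: ler_wpM2l => //; exact: b2.
apply/eqP.
transitivity (\int[mu]_s \int[mu]_t (0 : R)); last first.
  by rewrite /Rintegral integral0/= integral0.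
apply: eq_Rintegral => s _; apply: eq_Rintegral => t _.
rewrite [X in Rintegral _ _ X](_ : _ = (fun u : R =>
  2 * u * dprof (s ^+ 2 + t ^+ 2 + u ^+ 2) * c (s * y.1.1 + t * y.1.2 + u * y.2)
  + prof (s ^+ 2 + t ^+ 2 + u ^+ 2) * (c' (s * y.1.1 + t * y.1.2 + u * y.2) * y.2)));
    last first.
  by apply/funext => u; rewrite /dbump /bump /dot3/= -!expr2; ring.
have du u : is_derive u (1 : R) (fun u : R => s ^+ 2 + t ^+ 2 + u ^+ 2) (2 * u).
  by apply: is_derive_eq; rewrite /GRing.scale/=; ring.
have dl u : is_derive u (1 : R) (fun u : R => s * y.1.1 + t * y.1.2 + u * y.2) y.2.
  by apply: is_derive_eq; rewrite /GRing.scale/=; ring.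
have dp u : is_derive u (1 : R) (fun u : R => prof (s ^+ 2 + t ^+ 2 + u ^+ 2))
    (dprof (s ^+ 2 + t ^+ 2 + u ^+ 2) * (2 * u)).
  exact: (@is_derive1_comp _ prof _ _ _ _ (is_derive_prof _)).
have dcu u : is_derive u (1 : R) (fun u : R => c (s * y.1.1 + t * y.1.2 + u * y.2))
    (c' (s * y.1.1 + t * y.1.2 + u * y.2) * y.2).
  exact: (@is_derive1_comp _ c).
have big u : L <= `|u| -> 1 < `|thick (s ^+ 2 + t ^+ 2 + u ^+ 2)|.
  move=> Lu; apply: thick_gt1.
  have : L ^+ 2 <= u ^+ 2 by rewrite -(real_normK (num_real u)) lerXn2r ?nnegrE// ltW.
  rewrite exprMn (_ : (3 / 2) ^+ 2 = 9 / 4 :> R); last by field.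
  by have := sqr_ge0 s; have := sqr_ge0 t; lra.
apply: (@Rintegral_derive_eq0 (fun u : R => prof (s ^+ 2 + t ^+ 2 + u ^+ 2) *
   c (s * y.1.1 + t * y.1.2 + u * y.2)) _ L) => //.
- move=> u; apply: is_derive_eq; rewrite /GRing.scale/=; ring.
- have cu : continuous (fun u : R => s ^+ 2 + t ^+ 2 + u ^+ 2).
    by move=> u; apply/differentiable_continuous/derivable1_diffP; have [] := du u.
  have cl : continuous (fun u : R => s * y.1.1 + t * y.1.2 + u * y.2).
    by move=> u; apply/differentiable_continuous/derivable1_diffP; have [] := dl u.
  move=> u; apply: cvgD; apply: cvgM.
  + apply: cvgM; first by apply: cvgM; [exact: cvg_cst|exact: cvg_id].
    by apply: (@continuous_comp _ _ _ (fun u : R => s ^+ 2 + t ^+ 2 + u ^+ 2) dprof);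
      [exact: cu|exact: continuous_dprof].
  + by apply: (@continuous_comp _ _ _ (fun u : R => s * y.1.1 + t * y.1.2 + u * y.2) c);
    [exact: cl|exact: cc].
  + by apply: (@continuous_comp _ _ _ (fun u : R => s ^+ 2 + t ^+ 2 + u ^+ 2) prof);
    [exact: cu|exact: continuous_prof].
  + apply: cvgM; last exact: cvg_cst.
    by apply: (@continuous_comp _ _ _ (fun u : R => s * y.1.1 + t * y.1.2 + u * y.2) c');
      [exact: cl|exact: cc'].
- by move=> u /big h; rewrite prof_eq0// mul0r.
- by move=> u /big h; rewrite prof_eq0// dprof_eq0// mulr0 !mul0r addr0.
Qed.

(** Squared modulus of the Fourier transform of [bump], without the normalizing factor. *)
Definition energy (y : M3) : R := fcos bump y ^+ 2 + fsin bump y ^+ 2.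

(** A derivative in the third coordinate becomes a multiplication by [y.2]; it also exchanges the
    cosine and sine parts up to sign, which the sum of squares does not see. *)
Lemma energy_dbump (y : M3) :
  fcos dbump y ^+ 2 + fsin dbump y ^+ 2 = y.2 ^+ 2 * energy y.
Proof.
have cosn1 (t : R) : `|cos t| <= 1 by rewrite ler_norml cos_geN1 cos_le1.
have sinn1 (t : R) : `|sin t| <= 1 by rewrite ler_norml sin_geN1 sin_le1.
rewrite /fcos (@Rintegral_dbump cos (fun t => - sin t))//; last 2 first.
- by move=> t; apply: cvgN; exact: continuous_sin.
- by move=> t; rewrite normrN.
rewrite {1}/fsin (@Rintegral_dbump sin cos)//; last exact: continuous_cos.
rewrite (_ : \int[leb3]_x (bump x * - sin (dot3 x y)) = - fsin bump y); last first.
  rewrite -mulN1r /fsin -RintegralZl//.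
    by apply: eq_Rintegral => x _; ring.
  apply: (integrable_bounded (ltW L_gt0) (B := amp)).
    apply: measurable_funM; first exact: measurable_bump.
    apply: (@measurableT_comp _ _ _ _ _ _ (@sin R)); last exact: measurable_dot3.
    by apply: continuous_measurable_fun; exact: continuous_sin.
  by move=> x; rewrite normrM (le_trans _ (bump_box3 x))// ler_piMr.
by rewrite /energy -/(fcos bump y); ring.
Qed.

Lemma measurable_energy : measurable_fun [set: M3] energy.
Proof. exact: (measurable_fcos_fsin L_gt0 measurable_bump bump_box3). Qed.

Lemma energy_ge0 y : 0 <= energy y.
Proof. by rewrite addr_ge0 ?sqr_ge0. Qed.

End Profile.

(** * Slicing and the Coulomb kernel *)

Section Slices.
Variable R : realType.
Local Notation M := (measurableTypeR R).
Local Notation M3 := (M * M * M)%type.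
Local Notation mu := (@lebesgue_measure R).

Definition near1 (a r t : R) : R := box1 r (t - a).

Lemma near1E a r : near1 a r = \1_(`[a - r, a + r]%classic : set R).
Proof.
apply/funext => t; rewrite /near1 /box1 indicE.
by rewrite mem_setE in_itv/= ler_distl.
Qed.

Lemma near1_ge0 a r t : 0 <= near1 a r t.
Proof. exact: ler0n. Qed.

Lemma measurable_near1 a r : measurable_fun [set: M] (near1 a r).
Proof. by rewrite near1E; apply: measurable_indic; exact: measurable_itv. Qed.

Lemma integral_near1 (a r : R) : 0 <= r ->
  (\int[mu]_t (near1 a r t)%:E = (2 * r)%:E)%E.
Proof.
move=> r0; rewrite near1E integral_indic ?setIT//.
apply: (etrans (lebesgue_measure_itv _)); rewrite /= lte_fin.
case: ifPn => [_|]; first by rewrite -EFinB; congr EFin; lra.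
rewrite -leNgt => h; congr EFin; lra.
Qed.

Lemma integral_leb2_prod (a b : M -> R) (l : R) : 0 <= l ->
  measurable_fun [set: M] a -> measurable_fun [set: M] b ->
  (forall t, 0 <= a t) -> (forall t, 0 <= b t) ->
  (\int[leb2]_p (a p.1 * (b p.2 * l))%:E =
   (\int[mu]_t (a t)%:E) * (\int[mu]_t (b t)%:E) * l%:E)%E.
Proof.
move=> l0 ma mb a0 b0.
have ml : measurable_fun [set: M * M] (fun p => (a p.1 * (b p.2 * l))%:E).
  apply/measurable_EFinP; apply: measurable_funM; last apply: measurable_funM => //.
    exact: measurableT_comp ma measurable_fst.
  exact: measurableT_comp mb measurable_snd.
have l0' p : (0 <= (a p.1 * (b p.2 * l))%:E :> \bar R)%E.
  by rewrite lee_fin; apply: mulr_ge0 => //; exact: mulr_ge0.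
rewrite [LHS](@fubini_tonelli1 _ _ M M R mu mu _ ml l0') /fubini_F.
have bl : (\int[mu]_t (b t * l)%:E = (\int[mu]_t (b t)%:E) * l%:E)%E.
  under eq_integral do rewrite EFinM.
  rewrite ge0_integralZr//; first exact/measurable_EFinP.
  by move=> t _; rewrite lee_fin.
have bl0 : (0 <= \int[mu]_t (b t * l)%:E)%E.
  by apply: integral_ge0 => t _; rewrite lee_fin mulr_ge0.
under eq_integral => s _.
  rewrite (eq_integral (fun t => (a s)%:E * (b t * l)%:E)%E); last first.
    by move=> t _; rewrite -EFinM.
  rewrite ge0_integralZl//; last 3 first.
  - by apply/measurable_EFinP; exact: measurable_funM.
  - by move=> t _; rewrite lee_fin mulr_ge0.
  - by rewrite lee_fin.
  over.
rewrite ge0_integralZr//.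
- by rewrite bl muleA.
- exact/measurable_EFinP.
- by move=> t _; rewrite lee_fin.
Qed.

(** Meant for indicators [a] and [b] of intervals: a bound on every vertical line over a rectangle
    becomes a bound on the volume integral. *)
Lemma integral_slice_ge (a b : M -> R) (W : M3 -> R) (l : R) : 0 <= l ->
  measurable_fun [set: M] a -> measurable_fun [set: M] b ->
  measurable_fun [set: M3] W -> (forall t, 0 <= a t) -> (forall t, 0 <= b t) ->
  (forall x, 0 <= W x) ->
  (forall s t, (a s * (b t * l))%:E <= \int[mu]_u (W ((s, t), u))%:E)%E ->
  ((\int[mu]_t (a t)%:E) * (\int[mu]_t (b t)%:E) * l%:E <=
   \int[leb3]_x (W x)%:E)%E.
Proof.
move=> l0 ma mb mW a0 b0 W0 Wl; rewrite -integral_leb2_prod//.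
have mWE : measurable_fun [set: M3] (fun x => (W x)%:E) by exact/measurable_EFinP.
have W0E x : (0 <= (W x)%:E :> \bar R)%E by rewrite lee_fin.
rewrite [leRHS](@fubini_tonelli1 _ _ (M * M)%type M R leb2 mu _ mWE W0E).
apply: ge0_le_integral => //.
- by move=> p _; rewrite lee_fin; apply: mulr_ge0 => //; exact: mulr_ge0.
- apply/measurable_EFinP; apply: measurable_funM; last apply: measurable_funM => //.
    exact: measurableT_comp ma measurable_fst.
  exact: measurableT_comp mb measurable_snd.
- exact: (@measurable_fun_fubini_tonelli_F _ _ (M * M)%type M R mu _ mWE W0E).
- by move=> [s t] _; exact: Wl.
Qed.

(** Upper counterpart, for the volume of the cap and for each dyadic term of the Coulomb
    potential. *)
Lemma integral_slice_le (a b : M -> R) (W : M3 -> R) (l : R) : 0 <= l ->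
  measurable_fun [set: M] a -> measurable_fun [set: M] b ->
  measurable_fun [set: M3] W -> (forall t, 0 <= a t) -> (forall t, 0 <= b t) ->
  (forall x, 0 <= W x) ->
  (forall s t, \int[mu]_u (W ((s, t), u))%:E <= l%:E)%E ->
  (\int[leb3]_x (a x.1.1 * b x.1.2 * W x)%:E <=
   (\int[mu]_t (a t)%:E) * (\int[mu]_t (b t)%:E) * l%:E)%E.
Proof.
move=> l0 ma mb mW a0 b0 W0 Wl.
have mg : measurable_fun [set: M3] (fun x => a x.1.1 * b x.1.2 * W x).
  apply: measurable_funM => //; apply: measurable_funM.
    by apply: measurableT_comp ma _; exact: measurableT_comp measurable_fst measurable_fst.
  by apply: measurableT_comp mb _; exact: measurableT_comp measurable_snd measurable_fst.
have g0 x : 0 <= a x.1.1 * b x.1.2 * W x by apply: mulr_ge0 => //; exact: mulr_ge0.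
have mgE : measurable_fun [set: M3] (fun x => (a x.1.1 * b x.1.2 * W x)%:E).
  exact/measurable_EFinP.
have g0E x : (0 <= (a x.1.1 * b x.1.2 * W x)%:E :> \bar R)%E by rewrite lee_fin.
apply: (@le_trans _ _ (\int[leb2]_p (a p.1 * (b p.2 * l))%:E)%E).
  rewrite [leLHS](@fubini_tonelli1 _ _ (M * M)%type M R leb2 mu _ mgE g0E).
  apply: ge0_le_integral => //.
  - by move=> p _; exact: integral_ge0.
  - exact: (@measurable_fun_fubini_tonelli_F _ _ (M * M)%type M R mu _ mgE g0E).
  - apply/measurable_EFinP; apply: measurable_funM; last apply: measurable_funM => //.
      exact: measurableT_comp ma measurable_fst.
    exact: measurableT_comp mb measurable_snd.
  - move=> [s t] _ /=; rewrite /fubini_F.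
    rewrite (eq_integral (fun u => (a s * b t)%:E * (W ((s, t), u))%:E)%E); last first.
      by move=> u _; rewrite -EFinM.
    rewrite ge0_integralZl//.
    + by rewrite [(a s * (b t * l))%R]mulrA [in leRHS]EFinM; apply: lee_pmul => //;
        [rewrite lee_fin mulr_ge0|apply: integral_ge0 => u _; rewrite lee_fin].
    + by apply/measurable_EFinP; exact: measurableT_comp mW _.
    + by move=> u _; rewrite lee_fin.
    + by rewrite lee_fin mulr_ge0.
by rewrite integral_leb2_prod.
Qed.

(* [1/r] is dominated by the single dyadic term whose scale is comparable to
   [r]; this replaces the singular kernel by indicators of boxes. *)
Lemma inv_le_dyadic (D r : R) : 0 < D -> 0 < r -> exists k : nat,
  r^-1 <= 2 ^+ k.+1 / D /\ forall m, m <= r -> m <= D -> m <= D / 2 ^+ k.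
Proof.
move=> D0 r0.
have ex : exists n : nat, D / 2 ^+ n.+1 < r.
  have [n hn] : exists n : nat, D / r < n%:R.
    by exists (Num.Def.archi_bound (D / r)); exact/archi_boundP/divr_ge0/ltW/r0/ltW.
  exists n; rewrite ltr_pdivrMr ?exprn_gt0// mulrC -ltr_pdivrMr//.
  apply: lt_trans hn _; rewrite -natrX ltr_nat.
  by rewrite ltnW// ltn_expl.
(* Minimality of [k] gives [r <= D / 2^k], except for [k = 0], where the condition [m <= D] takes
   over. *)
have [k hk kmin] := ex_minnP ex.
exists k; split.
  rewrite -[X in _ <= X]invrK lef_pV2 ?posrE// ?invr_gt0 ?divr_gt0 ?exprn_gt0//.
  by rewrite invf_div ltW.
move=> m mr; case: k hk kmin => [_ _|k hk kmin] mD; first by rewrite expr0 divr1.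
by apply: le_trans mr _; rewrite leNgt; apply/negP => /kmin; rewrite ltnn.
Qed.

Lemma norm3_ge (z : M3) : `|z.1.1| <= norm3 z /\ `|z.1.2| <= norm3 z.
Proof.
by split; rewrite -sqrtr_sqr ler_wsqrtr// /dot3 -!expr2;
  have := sqr_ge0 z.1.1; have := sqr_ge0 z.1.2; have := sqr_ge0 z.2; lra.
Qed.

Lemma measurable_inv_norm3 d (T : measurableType d) (f g : T -> M3) :
  measurable_fun [set: T] f -> measurable_fun [set: T] g ->
  measurable_fun [set: T] (fun y => (norm3 (f y - g y))^-1).
Proof.
move=> mf mg.
have m11 : measurable_fun [set: M3] (fun x : M3 => x.1.1).
  exact: measurableT_comp measurable_fst measurable_fst.
have m12 : measurable_fun [set: M3] (fun x : M3 => x.1.2).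
  exact: measurableT_comp measurable_snd measurable_fst.
have m2 : measurable_fun [set: M3] (fun x : M3 => x.2) by exact: measurable_snd.
(* On nonnegative reals the inverse agrees with the power [-1], at 0 included, and real powers are
   measurable. *)
rewrite (_ : (fun y => _) = (fun y => norm3 (f y - g y) `^ (-1))); last first.
  by apply/funext => y; rewrite powR_inv1// sqrtr_ge0.
apply: measurableT_comp (@measurable_powR R (-1)) _.
apply: (@measurableT_comp _ _ _ _ _ _ (@Num.sqrt R)).
  by apply: continuous_measurable_fun; exact: sqrt_continuous.
have mfg : measurable_fun [set: T] (fun y =>
    ((f y).1.1 - (g y).1.1, (f y).1.2 - (g y).1.2, (f y).2 - (g y).2)).
  apply: measurable_fun_pair; [apply: measurable_fun_pair|]; apply: measurable_funB.
  - exact: measurableT_comp m11 mf.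
  - exact: measurableT_comp m11 mg.
  - exact: measurableT_comp m12 mf.
  - exact: measurableT_comp m12 mg.
  - exact: measurableT_comp m2 mf.
  - exact: measurableT_comp m2 mg.
exact: (measurable_dot3 mfg mfg).
Qed.

(** At scale [D / 2^k], the vertical column around [x] carries mass at most [(2 D / 2^k)^2 l] and
    the kernel counts for [2^(k+1) / D]. The product [8 D l / 2^k] sums to [16 D l]. Two coordinates
    suffice for the localization since whole vertical lines are integrated. *)
Lemma coulomb_slice_le (W : M3 -> R) (D l : R) (x : M3) : 0 < D -> 0 <= l ->
  measurable_fun [set: M3] W -> (forall y, 0 <= W y) ->
  (forall s t, \int[mu]_u (W ((s, t), u))%:E <= l%:E)%E ->
  (forall y, W y != 0 -> `|y.1.1 - x.1.1| <= D /\ `|y.1.2 - x.1.2| <= D) ->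
  (\int[leb3]_y (W y / norm3 (x - y))%:E <= (16 * D * l)%:E)%E.
Proof.
move=> D0 l0 mW W0 Wl WD.
pose rad k : R := D / 2 ^+ k.
have rad0 k : 0 <= rad k by rewrite divr_ge0 ?exprn_ge0// ltW.
pose V k (y : M3) := near1 x.1.1 (rad k) y.1.1 * near1 x.1.2 (rad k) y.1.2 * W y.
have V0 k y : 0 <= V k y.
  by apply: mulr_ge0 => //; apply: mulr_ge0; exact: near1_ge0.
have c0 k : 0 <= 2 ^+ k.+1 / D by rewrite divr_ge0 ?exprn_ge0// ltW.
pose f k (y : M3) := (2 ^+ k.+1 / D * V k y)%:E.
have f0 k y : (0 <= f k y)%E by rewrite lee_fin mulr_ge0.
have mV k : measurable_fun [set: M3] (V k).
  apply: measurable_funM => //; apply: measurable_funM.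
    by apply: measurableT_comp (@measurable_near1 _ _) _;
      exact: measurableT_comp measurable_fst measurable_fst.
  by apply: measurableT_comp (@measurable_near1 _ _) _;
    exact: measurableT_comp measurable_snd measurable_fst.
have mf k : measurable_fun [set: M3] (f k).
  by apply/measurable_EFinP; exact: measurable_funM.
have mLHS : measurable_fun [set: M3] (fun y => (W y / norm3 (x - y))%:E).
  apply/measurable_EFinP; apply: measurable_funM => //.
  by apply: measurable_inv_norm3 => //; exact: measurable_cst.
apply: (@le_trans _ _ (\int[leb3]_y \sum_(k <oo) f k y)%E).
  apply: ge0_le_integral => //.
  - by move=> y _; rewrite lee_fin divr_ge0// sqrtr_ge0.
  - exact: (ge0_emeasurable_sum (P := xpredT)).
  - move=> y _; have [Wy0|Wy] := eqVneq (W y) 0.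
      by rewrite Wy0 mul0r; exact: nneseries_ge0.
    (* At [y = x] the integrand is 0 by the convention [0^-1 = 0]. *)
    have [n0|n0] := eqVneq (norm3 (x - y)) 0.
      by rewrite n0 invr0 mulr0; exact: nneseries_ge0.
    have npos : 0 < norm3 (x - y) by rewrite lt_neqAle eq_sym n0 sqrtr_ge0.
    have [k [k1 k2]] := inv_le_dyadic D0 npos.
    have [d1 d2] := WD _ Wy.
    have [e1 e2] := norm3_ge (x - y).
    apply: (@le_trans _ _ (f k y)).
      rewrite lee_fin /V /near1 /box1.
      rewrite (_ : (_ <= rad k)); last first.
        by apply: k2 => //; apply: le_trans e1; rewrite distrC.
      rewrite (_ : (_ <= rad k)); last first.
        by apply: k2 => //; apply: le_trans e2; rewrite distrC.
      by rewrite !mul1r mulrC ler_wpM2r.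
    apply: le_trans (nneseries_lim_ge k.+1 (fun n _ _ => f0 n y)).
    by rewrite big_nat_recr//= leeDr// sume_ge0.
rewrite integral_nneseries//.
apply: lime_le.
  by apply: is_cvg_nneseries => n _ _; apply: integral_ge0 => y _; exact: f0.
apply: nearW => n.
have I k : (\int[leb3]_y f k y <= (8 * D * l / 2 ^+ k)%:E)%E.
  rewrite /f; under eq_integral do rewrite EFinM.
  rewrite ge0_integralZl//; last 3 first.
  - exact/measurable_EFinP.
  - by move=> y _; rewrite lee_fin V0.
  - by rewrite lee_fin.
  rewrite (_ : (8 * D * l / 2 ^+ k)%:E = (2 ^+ k.+1 / D)%:E * ((2 * rad k)%:E * (2 * rad
    k)%:E * l%:E))%E.
    apply: lee_wpmul2l; first by rewrite lee_fin.
    have := @integral_slice_le (near1 x.1.1 (rad k)) (near1 x.1.2 (rad k)) W l l0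
      (measurable_near1 _ _) (measurable_near1 _ _) mW (near1_ge0 _ _) (near1_ge0 _ _) W0 Wl.
    by rewrite !integral_near1.
  rewrite -!EFinM; congr EFin; rewrite /rad exprS; field.
  by rewrite gt_eqF ?exprn_gt0// gt_eqF.
apply: (@le_trans _ _ (\sum_(0 <= k < n) (8 * D * l / 2 ^+ k)%:E)%E).
  by apply: lee_sum => k _; exact: I.
rewrite sumEFin lee_fin.
have -> : \sum_(0 <= k < n) (8 * D * l / 2 ^+ k) = 8 * D * l * (2 - 2 / 2 ^+ n).
  elim: n => [|n IH]; first by rewrite big_nil expr0; field.
  rewrite big_nat_recr//= IH exprS; field.
  by rewrite gt_eqF ?exprn_gt0.
have : 0 <= 8 * D * l * (2 / 2 ^+ n).
  by rewrite !mulr_ge0 ?invr_ge0 ?exprn_ge0// ltW.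
lra.
Qed.

End Slices.

(** * Geometry of the shell *)

Section Geometry.
Variable R : realType.
Local Notation M := (measurableTypeR R).
Local Notation M3 := (M * M * M)%type.
Local Notation mu := (@lebesgue_measure R).

Variables (S lam : R).
Hypotheses (S_gt0 : 0 < S) (Slam : 4 * S <= lam).

Let lam_gt0 : 0 < lam. Proof. by apply: lt_le_trans Slam; rewrite mulr_gt0. Qed.
Let lamS_gt0 : 0 < lam * S. Proof. exact: mulr_gt0. Qed.

Local Notation shellS := (shell S lam).
Local Notation thickS := (thick S lam).

Lemma shellP x : shellS x = 1 -> `|dot3 x x - lam ^+ 2| <= lam * S.
Proof.
rewrite /shell; case: (lerP `|thickS _| 1) => // [h _|_ /eqP]; last first.
  by rewrite eq_sym oner_eq0.
move: h; rewrite /thick normrM normfV (ger0_norm (ltW lamS_gt0)).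
by rewrite ler_pdivrMr// mul1r.
Qed.

(* Away from the equator, the shell meets each vertical line in a set of length
   [O(S)]; the images of [cap] under permutations of the coordinates cover the
   whole shell. *)
Definition cap (x : M3) : R := shellS x * (lam / 2 <= `|x.2|)%R%:R.

Lemma cap_ge0 x : 0 <= cap x.
Proof. by rewrite mulr_ge0 ?ler0n. Qed.

Lemma cap_neq0 x : cap x != 0 -> shellS x = 1 /\ lam / 2 <= `|x.2|.
Proof.
rewrite /cap; case: (shell_01 S lam x) => ->; last by rewrite mul0r eqxx.
by case: (lerP (lam / 2) `|x.2|) => //; rewrite mulr0 eqxx.
Qed.

Lemma cap_le1 x : cap x <= 1.
Proof.
rewrite /cap; case: (shell_01 S lam x) => ->; rewrite ?mul0r ?mul1r//.
by case: (lerP (lam / 2) `|x.2|).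
Qed.

Lemma measurable_cap : measurable_fun [set: M3] cap.
Proof.
apply: measurable_funM; first exact: measurable_shell.
have m2 : measurable_fun [set: M3] (fun x : M3 => `|x.2|).
  by apply: measurableT_comp => //; exact: measurable_snd.
have := @measurable_fun_ler _ _ _ setT (fun=> lam / 2) (fun x : M3 => `|x.2|) (measurable_cst
  _) m2.
move=> mb; apply: (@measurableT_comp _ _ _ _ _ _ (fun b : bool => b%:R : R)) => //.
Qed.

(** If heights [u] and [u0] on one line both belong to the cap, then [|u^2 - u0^2| <= 2 lam S] while
    [|u| + |u0| >= lam], so [|u|] is within [2 S] of [|u0|]. The slice lies in two intervals of
    length [4 S], centred at [|u0|] and [-|u0|]. *)
Lemma cap_slice (s t : R) : (\int[mu]_u (cap ((s, t), u))%:E <= (8 * S)%:E)%E.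
Proof.
have [ex|nex] := pselect (exists u, cap ((s, t), u) != 0); last first.
  rewrite (eq_integral (fun=> 0%E)); last first.
    move=> u _; congr EFin; apply/eqP/negPn/negP => h; apply: nex; by exists u.
  by rewrite integral0 lee_fin mulr_ge0// ltW.
have [u0 /cap_neq0[/shellP/= h0 h0']] := ex.
apply: (@le_trans _ _ (\int[mu]_u ((near1 `|u0| (2 * S) u)%:E + (near1 (- `|u0|) (2 * S)
  u)%:E))%E).
  apply: ge0_le_integral => //.
  - by move=> u _; rewrite lee_fin cap_ge0.
  - by apply/measurable_EFinP;
    exact: (measurableT_comp measurable_cap (pair1_measurable (s, t))).
  - apply: emeasurable_funD; apply/measurable_EFinP; exact: measurable_near1.
  - move=> u _; rewrite -EFinD lee_fin.
    have [->|/cap_neq0[/shellP/= h h']] := eqVneq (cap ((s, t), u)) 0.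
      by rewrite addr_ge0 ?near1_ge0.
    apply: le_trans (cap_le1 _) _.
    have close : `| `|u| - `|u0| | <= 2 * S.
      have e : (`|u| - `|u0|) * (`|u| + `|u0|) = u ^+ 2 - u0 ^+ 2.
        by rewrite -[u ^+ 2]real_normK ?num_real// -[u0 ^+ 2]real_normK ?num_real//; ring.
      have : `|u ^+ 2 - u0 ^+ 2| <= 2 * (lam * S).
        move: h h0; rewrite /dot3/= -!expr2 !ler_norml => /andP[? ?] /andP[? ?].
        by apply/andP; split; lra.
      rewrite -e normrM (ger0_norm (addr_ge0 (normr_ge0 u) (normr_ge0 u0))) => H.
      rewrite -(ler_pM2r lam_gt0); apply: (@le_trans _ _ (2 * (lam * S))); last by lra.
      by apply: le_trans H; rewrite ler_wpM2l//; lra.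
    have [u_ge0|u_lt0] := lerP 0 u.
      rewrite (_ : near1 `|u0| _ u = 1) ?lerDl ?near1_ge0//.
      by move: close; rewrite (ger0_norm u_ge0) /near1 /box1 => ->.
    rewrite (_ : near1 (- `|u0|) _ u = 1) ?lerDr ?near1_ge0//.
    move: close; rewrite (ltr0_norm u_lt0) -opprD normrN => H.
    by rewrite /near1 /box1 opprK H.
rewrite ge0_integralD//; last 4 first.
- by move=> u _; rewrite lee_fin near1_ge0.
- by apply/measurable_EFinP; exact: measurable_near1.
- by move=> u _; rewrite lee_fin near1_ge0.
- by apply/measurable_EFinP; exact: measurable_near1.
by rewrite !integral_near1 ?mulr_ge0 ?(ltW S_gt0)// -EFinD lee_fin; lra.
Qed.

(** If all three coordinates were below [lam / 2] in absolute value, then [|x|^2 < 3/4 lam^2],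
    whereas on the shell [|x|^2 >= lam^2 - lam S >= 3/4 lam^2]. *)
Lemma shell_le_cap x :
  shellS x <= cap x + cap (swap23 x) + cap (swap23 (swap12 x)).
Proof.
have c0 := cap_ge0.
case: (shell_01 S lam x) => hx; last by rewrite hx !addr_ge0.
have sw1 : shellS (swap23 x) = shellS x.
  by rewrite /shell /dot3 /swap23/=; congr (nat_of_bool (`|thickS _| <= 1))%R%:R; ring.
have sw2 : shellS (swap23 (swap12 x)) = shellS x.
  by rewrite /shell /dot3 /swap23 /swap12/=; congr (nat_of_bool (`|thickS _| <= 1))%R%:R; ring.
have [h1|h1] := lerP (lam / 2) `|x.2|.
  by rewrite /cap h1 hx mul1r -addrA lerDl addr_ge0 ?c0.
have [h2|h2] := lerP (lam / 2) `|x.1.2|.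
  rewrite {2}/cap sw1 /swap23/= h2 hx mul1r addrAC lerDr addr_ge0 ?c0//.
have [h3|h3] := lerP (lam / 2) `|x.1.1|.
  rewrite {3}/cap sw2 /swap23/= h3 hx mul1r lerDr addr_ge0 ?c0//.
exfalso; have := shellP hx; rewrite ler_norml => /andP[+ _].
have sq (a : R) : `|a| < lam / 2 -> a * a < lam ^+ 2 / 4.
  move=> ha; rewrite -expr2 -real_normK ?num_real//.
  apply: (@lt_le_trans _ _ ((lam / 2) ^+ 2));
    first by rewrite ltrXn2r ?nnegrE ?divr_ge0 ?(ltW lam_gt0).
  by rewrite le_eqVlt; apply/orP; left; apply/eqP; field.
have := sq _ h1; have := sq _ h2; have := sq _ h3.
have : lam * S <= lam ^+ 2 / 4.
  have : lam * (4 * S) <= lam * lam by rewrite ler_pM2l.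
  by rewrite expr2; lra.
rewrite /dot3; lra.
Qed.

Lemma measurable_swap23 : measurable_fun [set: M3] (@swap23 R).
Proof.
apply: measurable_fun_pair; last exact: measurableT_comp measurable_snd measurable_fst.
apply: measurable_fun_pair; last exact: measurable_snd.
exact: measurableT_comp measurable_fst measurable_fst.
Qed.

Lemma measurable_swap12 : measurable_fun [set: M3] (@swap12 R).
Proof.
apply: measurable_fun_pair; last exact: measurable_snd.
apply: measurable_fun_pair.
  exact: measurableT_comp measurable_snd measurable_fst.
exact: measurableT_comp measurable_fst measurable_fst.
Qed.

(* The weight [k] is [1] for the volume and the Coulomb kernel otherwise. *)
Lemma integral_shell_le (k k1 k2 : M3 -> R) (C : R) :
  measurable_fun [set: M3] k -> measurable_fun [set: M3] k1 ->
  measurable_fun [set: M3] k2 ->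
  (forall x, 0 <= k x) -> (forall x, 0 <= k1 x) -> (forall x, 0 <= k2 x) ->
  (forall x, k1 (swap23 x) = k x) -> (forall x, k2 (swap23 (swap12 x)) = k x) ->
  (\int[leb3]_x (cap x * k x)%:E <= C%:E)%E ->
  (\int[leb3]_x (cap x * k1 x)%:E <= C%:E)%E ->
  (\int[leb3]_x (cap x * k2 x)%:E <= C%:E)%E ->
  (\int[leb3]_x (shellS x * k x)%:E <= (3 * C)%:E)%E.
Proof.
move=> mk mk1 mk2 k0 k10 k20 k1E k2E Hk Hk1 Hk2.
have mc := measurable_cap.
have m0 : measurable_fun [set: M3] (fun x => (cap x * k x)%:E).
  by apply/measurable_EFinP; exact: measurable_funM.
have m1 : measurable_fun [set: M3] (fun x => (cap x * k1 x)%:E).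
  by apply/measurable_EFinP; exact: measurable_funM.
have m2 : measurable_fun [set: M3] (fun x => (cap x * k2 x)%:E).
  by apply/measurable_EFinP; exact: measurable_funM.
have m1' := measurableT_comp m1 measurable_swap23.
have m2' := measurableT_comp m2 measurable_swap23.
have m2'' := measurableT_comp m2' measurable_swap12.
have I1 : (\int[leb3]_x (cap (swap23 x) * k1 (swap23 x))%:E <= C%:E)%E.
  by apply: le_trans Hk1; rewrite le_eqVlt; apply/orP; left;
    apply/eqP/esym/(integral_swap23 m1).
have I2 : (\int[leb3]_x (cap (swap23 (swap12 x)) * k2 (swap23 (swap12 x)))%:E <= C%:E)%E.
  apply: le_trans Hk2; rewrite le_eqVlt; apply/orP; left; apply/eqP/esym.
  exact: (etrans (integral_swap23 m2) (integral_swap12 m2')).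
have c0 x : (0 <= (cap x * k x)%:E)%E by rewrite lee_fin mulr_ge0// cap_ge0.
have c1 x : (0 <= (cap (swap23 x) * k1 (swap23 x))%:E)%E by rewrite lee_fin mulr_ge0// cap_ge0.
have c2 x : (0 <= (cap (swap23 (swap12 x)) * k2 (swap23 (swap12 x)))%:E)%E.
  by rewrite lee_fin mulr_ge0// cap_ge0.
apply: (@le_trans _ _ (\int[leb3]_x ((cap x * k x)%:E +
   ((cap (swap23 x) * k1 (swap23 x))%:E
   + (cap (swap23 (swap12 x)) * k2 (swap23 (swap12 x)))%:E)))%E).
  apply: ge0_le_integral => //.
  - by move=> x _; rewrite lee_fin mulr_ge0// shell_ge0.
  - by apply/measurable_EFinP; apply: measurable_funM => //; exact: measurable_shell.
  - apply: emeasurable_funD; [exact: m0|apply: emeasurable_funD; [exact: m1'|exact: m2'']].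
  - move=> x _; rewrite -!EFinD lee_fin k1E k2E -!mulrDl ler_wpM2r// addrA.
    exact: shell_le_cap.
rewrite ge0_integralD//; last 2 first.
- by move=> x _; exact: adde_ge0.
- by apply: emeasurable_funD; [exact: m1'|exact: m2''].
rewrite ge0_integralD//.
by rewrite (_ : 3 * C = C + (C + C)) ?EFinD; [apply: leeD => //; exact: leeD|ring].
Qed.

Let L : R := 3 / 2 * lam.

Lemma cap_le_box1 x : cap x = box1 L x.1.1 * box1 L x.1.2 * cap x.
Proof.
have [->|/cap_neq0[h _]] := eqVneq (cap x) 0; first by rewrite mulr0.
have := shell_box3 S_gt0 Slam x; rewrite h /box3 /box1 -/L.
case: (lerP `|x.1.1| L) => _; case: (lerP `|x.1.2| L) => _;
  rewrite ?mul0r ?mulr0 ?ler10// ?mul0r ?ler10// !mul1r//.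
Qed.

(** A base square of side [2 * L = 3 * lam], with slices of length at most [8 * S]. *)
Lemma integral_cap_le : (\int[leb3]_x (cap x)%:E <= (72 * lam ^+ 2 * S)%:E)%E.
Proof.
have L0 : 0 <= L by rewrite mulr_ge0 ?(ltW lam_gt0).
have S8 : 0 <= 8 * S by rewrite mulr_ge0 ?(ltW S_gt0).
under eq_integral do rewrite cap_le_box1.
have := integral_slice_le S8 (@measurable_box1 R L) (@measurable_box1 R L) measurable_cap
  (box1_ge0 L) (box1_ge0 L) cap_ge0 cap_slice.
rewrite integral_box1// => H; apply: le_trans H _.
by rewrite -!EFinM lee_fin le_eqVlt; apply/orP; left; apply/eqP; rewrite /L; field.
Qed.

Lemma integral_shell_vol : (\int[leb3]_x (shellS x)%:E <= (216 * lam ^+ 2 * S)%:E)%E.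
Proof.
have H : (\int[leb3]_x (cap x * 1)%:E <= (72 * lam ^+ 2 * S)%:E)%E.
  by under eq_integral do rewrite mulr1; exact: integral_cap_le.
have m1 : measurable_fun [set: M3] (fun=> 1 : R) by exact: measurable_cst.
have := integral_shell_le m1 m1 m1 (fun=> ler01) (fun=> ler01) (fun=> ler01)
  (fun=> erefl) (fun=> erefl) H H H.
under eq_integral do rewrite mulr1.
by rewrite (_ : 3 * _ = 216 * lam ^+ 2 * S)//; ring.
Qed.

(** Coordinates in the box differ by at most [2 * L = 3 * lam], which is the largest dyadic scale
    [D]; the constant is [16 * 3 * 8]. *)
Lemma integral_cap_coulomb (x : M3) :
  `|x.1.1| <= L -> `|x.1.2| <= L ->
  (\int[leb3]_y (cap y * (norm3 (x - y))^-1)%:E <= (384 * lam * S)%:E)%E.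
Proof.
move=> x1 x2.
have D0 : 0 < 3 * lam by rewrite mulr_gt0.
have S8 : 0 <= 8 * S by rewrite mulr_ge0 ?(ltW S_gt0).
have := @coulomb_slice_le R cap (3 * lam) (8 * S) x D0 S8 measurable_cap cap_ge0 cap_slice.
rewrite (_ : 16 * _ * _ = 384 * lam * S); last by ring.
apply=> y ny; have := cap_le_box1 y; rewrite /box1.
case: (lerP `|y.1.1| L) => [y1|_]; last by move/eqP; rewrite !mul0r (negbTE ny).
case: (lerP `|y.1.2| L) => [y2 _|_]; last by move/eqP; rewrite mulr0 mul0r (negbTE ny).
have e : 3 * lam = L + L by rewrite /L; field.
by rewrite e; split; apply: le_trans (ler_normB _ _) _; exact: lerD.
Qed.

(** Permuting the coordinates of both points preserves their distance, so the three caps amount to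
    one cap seen from three permuted copies of [x]. All coordinates of [x] are at most [L] in
    absolute value, so each copy is admissible. *)
Lemma integral_shell_coulomb (x : M3) : shellS x = 1 ->
  (\int[leb3]_y (shellS y / norm3 (x - y))%:E <= (1152 * lam * S)%:E)%E.
Proof.
move=> hx.
have [b1 [b2 b3]] : `|x.1.1| <= L /\ `|x.1.2| <= L /\ `|x.2| <= L.
  have := shell_box3 S_gt0 Slam x; rewrite hx /box3 /box1 -/L.
  case: (lerP `|x.1.1| L) => _; case: (lerP `|x.1.2| L) => _; case: (lerP `|x.2| L) => _;
    by rewrite ?(mul0r, mulr0) ?ler10.
have mk (z : M3) : measurable_fun [set: M3] (fun y => (norm3 (z - y))^-1).
  by apply: measurable_inv_norm3 => //; exact: measurable_cst.
have k0 (z y : M3) : 0 <= (norm3 (z - y))^-1 by rewrite invr_ge0 sqrtr_ge0.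
have := @integral_shell_le _ _ _ (384 * lam * S) (mk x) (mk (swap23 x))
  (mk (swap23 (swap12 x))) (k0 _) (k0 _) (k0 _).
rewrite (_ : 3 * _ = 1152 * lam * S); last by ring.
apply.
- by move=> y; rewrite /norm3 /dot3 /swap23/=; congr (Num.sqrt _)^-1; ring.
- by move=> y; rewrite /norm3 /dot3 /swap23 /swap12/=; congr (Num.sqrt _)^-1; ring.
- exact: integral_cap_coulomb.
- exact: integral_cap_coulomb.
- exact: integral_cap_coulomb.
Qed.

End Geometry.

(** * * Integral estimates for the shell *)

Section Estimates.
Variable R : realType.
Local Notation M := (measurableTypeR R).
Local Notation M3 := (M * M * M)%type.
Local Notation mu := (@lebesgue_measure R).

Variables (S lam amp : R).
Hypotheses (S_gt0 : 0 < S) (Slam : 4 * S <= lam) (amp_gt0 : 0 < amp).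

Let lam_gt0 : 0 < lam. Proof. by apply: lt_le_trans Slam; rewrite mulr_gt0. Qed.
Let lamS_gt0 : 0 < lam * S. Proof. exact: mulr_gt0. Qed.

Local Notation shellS := (shell S lam).
Local Notation thickS := (thick S lam).
Local Notation bumpS := (bump S lam amp).
Local Notation dbumpS := (dbump S lam amp).
Local Notation energyS := (energy S lam amp).

Lemma flat1_ge (t : R) : 3 / 4 <= t -> expR (- (4 / 3)) <= flat 1 t.
Proof.
move=> ht; have t0 : 0 < t by lra.
rewrite /flat t0 hornerC mul1r ler_expR lerN2.
by rewrite (_ : 4 / 3 = (3 / 4)^-1); [rewrite lef_pV2 ?posrE//; lra|field].
Qed.

Lemma bump_ge0 x : 0 <= bumpS x.
Proof. exact: prof_ge0. Qed.

(** The vertical line meets the sphere of radius [lam] at height [c]. For [c <= u <= c + S / 8], the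
    increment [u^2 - c^2] is between 0 and [lam S / 2], so [thick] is at most [1 / 2] and the
    argument of [flat] at least [3 / 4]. *)
Lemma bump_slice_ge (p s t : R) : 0 <= p -> 0 <= s <= lam / 2 -> 0 <= t <= lam / 2 ->
  (((amp * expR (- (4 / 3))) `^ p * (S / 8))%:E <= \int[mu]_u (bumpS ((s, t), u) `^ p)%:E)%E.
Proof.
move=> p0 /andP[s0 s1] /andP[t0 t1].
have a0 : 0 <= amp * expR (- (4 / 3)) by rewrite mulr_ge0 ?expR_ge0 ?(ltW amp_gt0).
have sq a : 0 <= a -> a <= lam / 2 -> a ^+ 2 <= lam ^+ 2 / 4.
  move=> ha ha'; apply: (@le_trans _ _ ((lam / 2) ^+ 2));
    first by rewrite lerXn2r// nnegrE divr_ge0 ?(ltW lam_gt0).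
  by rewrite le_eqVlt; apply/orP; left; apply/eqP; field.
have s2 := sq _ s0 s1; have t2 := sq _ t0 t1.
have S16 : 0 <= S / 16 by rewrite divr_ge0 ?(ltW S_gt0).
pose c := Num.sqrt (lam ^+ 2 - s ^+ 2 - t ^+ 2).
have c2 : c ^+ 2 = lam ^+ 2 - s ^+ 2 - t ^+ 2.
  by rewrite sqr_sqrtr//; have := sqr_ge0 lam; lra.
have c0 : 0 <= c by exact: sqrtr_ge0.
have cl : c <= lam.
  rewrite -(@ler_pXn2r _ 2)// ?nnegrE ?(ltW lam_gt0)// c2.
  by have := sqr_ge0 s; have := sqr_ge0 t; lra.
apply: (@le_trans _ _ (\int[mu]_u ((amp * expR (- (4 / 3))) `^ p * near1 (c + S / 16) (S /
  16) u)%:E)%E).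
  under eq_integral do rewrite EFinM.
  rewrite ge0_integralZl//; last 3 first.
  - by apply/measurable_EFinP; exact: measurable_near1.
  - by move=> u _; rewrite lee_fin near1_ge0.
  - by rewrite lee_fin powR_ge0.
  by rewrite integral_near1// -EFinM lee_fin le_eqVlt; apply/orP; left; apply/eqP; field.
apply: ge0_le_integral => //.
- by move=> u _; rewrite lee_fin mulr_ge0 ?powR_ge0 ?near1_ge0.
- by apply/measurable_EFinP; apply: measurable_funM => //; exact: measurable_near1.
- apply/measurable_EFinP; apply: measurableT_comp (@measurable_powR R p) _.
  exact: (measurableT_comp (measurable_bump amp S_gt0 Slam) (pair1_measurable (s, t))).
- move=> u _; rewrite lee_fin /near1 /box1.
  case: (lerP `|u - _| (S / 16)) => [|_]; last by rewrite mulr0 powR_ge0.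
  rewrite ler_norml => /andP[u1 u2]; rewrite mulr1.
  have cu : c <= u by lra.
  have uc : u <= c + S / 8 by lra.
  apply: ge0_ler_powR => //; rewrite ?nnegrE ?bump_ge0//.
  rewrite /bump /prof ler_wpM2l ?(ltW amp_gt0)//; apply: flat1_ge.
  have w0 : 0 <= thickS (dot3 ((s, t), u) ((s, t), u)).
    rewrite /thick divr_ge0 ?(ltW lamS_gt0)// /dot3/= -!expr2.
    have : c ^+ 2 <= u ^+ 2 by rewrite lerXn2r// nnegrE// (le_trans c0).
    lra.
  have w1 : thickS (dot3 ((s, t), u) ((s, t), u)) <= 1 / 2.
    rewrite /thick ler_pdivrMr// /dot3/= -!expr2.
    have : u ^+ 2 <= (c + S / 8) ^+ 2.
      by rewrite lerXn2r// nnegrE; [exact: le_trans cu|lra].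
    have cS : c * S <= lam * S by rewrite ler_pM2r.
    have SS : S * (4 * S) <= S * lam by rewrite ler_pM2l.
    have lS0 := lamS_gt0.
    by rewrite sqrrD c2 !expr2; lra.
  have : thickS (dot3 ((s, t), u) ((s, t), u)) ^+ 2 <= (1 / 2) ^+ 2.
    by rewrite lerXn2r// nnegrE//; lra.
  by rewrite (_ : (1 / 2) ^+ 2 = 1 / 4 :> R); [lra|field].
Qed.

Lemma integral_bump_ge (p : R) : 0 <= p ->
  (((amp * expR (- (4 / 3))) `^ p * (lam ^+ 2 * S / 32))%:E <=
   \int[leb3]_x (bumpS x `^ p)%:E)%E.
Proof.
move=> p0.
have l4 : 0 <= lam / 4 by rewrite divr_ge0 ?(ltW lam_gt0).
have mb : measurable_fun [set: M3] (fun x => bumpS x `^ p).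
  exact: measurableT_comp (@measurable_powR R p) (measurable_bump amp S_gt0 Slam).
have l0 : 0 <= (amp * expR (- (4 / 3))) `^ p * (S / 8).
  by rewrite mulr_ge0 ?powR_ge0// divr_ge0 ?(ltW S_gt0).
(* The base points fill the square [[0, lam / 2]^2], of area [lam^2 / 4]; with slices of length
   [S / 8] this gives the factor [1 / 32]. *)
have := @integral_slice_ge R (near1 (lam / 4) (lam / 4)) (near1 (lam / 4) (lam / 4))
  (fun x => bumpS x `^ p) _ l0 (measurable_near1 _ _) (measurable_near1 _ _) mb
  (near1_ge0 _ _) (near1_ge0 _ _) (fun x => powR_ge0 _ _).
rewrite !integral_near1// -!EFinM.
rewrite (_ : _ * (_ * (S / 8)) = (amp * expR (- (4 / 3))) `^ p * (lam ^+ 2 * S / 32));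
  last by field.
apply => s t.
have i0 : (0 <= \int[mu]_u (bumpS ((s, t), u) `^ p)%:E)%E.
  by apply: integral_ge0 => u _; rewrite lee_fin powR_ge0.
rewrite /near1 /box1.
case: (lerP `|s - _| _) => [|_]; last by rewrite mul0r.
case: (lerP `|t - _| _) => [|_]; last by rewrite mul0r mulr0.
rewrite !ler_norml => /andP[t1 t2] /andP[s1 s2]; rewrite !mul1r.
by apply: bump_slice_ge => //; apply/andP; split; lra.
Qed.

Lemma integral_shell_scale (f : M3 -> R) (c : R) : 0 <= c ->
  measurable_fun [set: M3] f -> (forall x, `|f x| <= c * shellS x) ->
  (\int[leb3]_x (f x ^+ 2)%:E <= (c ^+ 2 * (216 * lam ^+ 2 * S))%:E)%E.
Proof.
move=> c0 mf fc.
have mS : measurable_fun [set: M3] (fun x => (shellS x)%:E).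
  by apply/measurable_EFinP; exact: measurable_shell.
apply: (@le_trans _ _ (\int[leb3]_x ((c ^+ 2)%:E * (shellS x)%:E))%E).
  apply: ge0_le_integral => //.
  - by move=> x _; rewrite lee_fin sqr_ge0.
  - by apply/measurable_EFinP; exact: measurable_funX.
  - by apply: measurable_funeM.
  - move=> x _; rewrite -EFinM lee_fin -real_normK ?num_real//.
    apply: (@le_trans _ _ ((c * shellS x) ^+ 2)).
      by rewrite lerXn2r ?nnegrE// mulr_ge0 ?shell_ge0.
    by case: (shell_01 S lam x) => ->; rewrite ?mulr1// !mulr0 expr0n.
rewrite ge0_integralZl//; last 2 first.
- by move=> x _; rewrite lee_fin shell_ge0.
- by rewrite lee_fin sqr_ge0.
rewrite (EFinM (c ^+ 2)); apply: lee_wpmul2l; first by rewrite lee_fin sqr_ge0.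
exact: integral_shell_vol.
Qed.

Definition plconst : R := (10 * pi) ^+ 3.

Lemma plconst_ge0 : 0 <= plconst.
Proof. by rewrite exprn_ge0// mulr_ge0// pi_ge0. Qed.

Lemma integral_energy :
  (\int[leb3]_y (energyS y)%:E <= (plconst * (amp ^+ 2 * (216 * lam ^+ 2 * S)))%:E)%E.
Proof.
have L0 : 0 < 3 / 2 * lam by rewrite mulr_gt0.
have mb := measurable_bump amp S_gt0 Slam.
apply: le_trans (plancherel_le L0 mb (bump_box3 S_gt0 Slam amp_gt0)) _.
rewrite (EFinM plconst); apply: lee_wpmul2l; first by rewrite lee_fin plconst_ge0.
by apply: integral_shell_scale => //; [exact: ltW|exact: bump_le].
Qed.

(** The Plancherel inequality for [dbump], read through [energy_dbump]. *)
Lemma integral_energy_z (C : R) : 0 <= C ->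
  (forall t : R, t <= 1 -> `|flat (flat_deriv 1) t| <= C) ->
  (\int[leb3]_y (y.2 ^+ 2 * energyS y)%:E <=
   (plconst * ((6 * C * amp / S) ^+ 2 * (216 * lam ^+ 2 * S)))%:E)%E.
Proof.
move=> C0 hC.
have L0 : 0 < 3 / 2 * lam by rewrite mulr_gt0.
have mb := measurable_dbump amp S_gt0 Slam.
under eq_integral do rewrite -(energy_dbump S_gt0 Slam amp_gt0).
apply: le_trans (plancherel_le L0 mb (fun x => @dbump_box3 R S lam amp S_gt0 Slam amp_gt0 C x
  C0 hC)) _.
rewrite (EFinM plconst); apply: lee_wpmul2l; first by rewrite lee_fin plconst_ge0.
apply: integral_shell_scale => //.
  by rewrite divr_ge0 ?(ltW S_gt0)// !mulr_ge0 ?(ltW amp_gt0).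
by move=> x; exact: dbump_le.
Qed.

(** The same transposition is applied to [x]: it fixes [bump] and preserves scalar products. *)
Lemma fourier_swap23 (c : R -> R) (y : M3) : measurable_fun [set: R] c ->
  \int[leb3]_x (bumpS x * c (dot3 x (swap23 y))) =
  \int[leb3]_x (bumpS x * c (dot3 x y)).
Proof.
move=> mc; congr fine.
have mg : measurable_fun [set: M3] (fun x => (bumpS x * c (dot3 x (swap23 y)))%:E).
  apply/measurable_EFinP; apply: measurable_funM; first exact: measurable_bump.
  by apply: measurableT_comp mc _; exact: measurable_dot3.
apply: (etrans (integral_swap23 mg)); apply: eq_integral => x _; congr EFin.
congr (prof _ _ _ _ * c _); rewrite /dot3 /swap23/=; ring.
Qed.

Lemma fourier_swap12 (c : R -> R) (y : M3) : measurable_fun [set: R] c ->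
  \int[leb3]_x (bumpS x * c (dot3 x (swap12 y))) =
  \int[leb3]_x (bumpS x * c (dot3 x y)).
Proof.
move=> mc; congr fine.
have mg : measurable_fun [set: M3] (fun x => (bumpS x * c (dot3 x (swap12 y)))%:E).
  apply/measurable_EFinP; apply: measurable_funM; first exact: measurable_bump.
  by apply: measurableT_comp mc _; exact: measurable_dot3.
apply: (etrans (integral_swap12 mg)); apply: eq_integral => x _; congr EFin.
congr (prof _ _ _ _ * c _); rewrite /dot3 /swap12/=; ring.
Qed.

Lemma energy_swap23 (y : M3) : energyS (swap23 y) = energyS y.
Proof.
rewrite /energy /fcos /fsin !fourier_swap23//.
  by apply: continuous_measurable_fun; exact: continuous_sin.
exact: measurable_cos.
Qed.

Lemma energy_swap12 (y : M3) : energyS (swap12 y) = energyS y.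
Proof.
rewrite /energy /fcos /fsin !fourier_swap12//.
  by apply: continuous_measurable_fun; exact: continuous_sin.
exact: measurable_cos.
Qed.

(** The interpolation between L^2 and H^1 at the level of Fourier multipliers; [s <= 1] enters for
    [a > 1]. *)
Lemma powR_le1Dsqr (s a : R) : 0 <= s -> s <= 1 -> 0 <= a ->
  a `^ (2 * s) <= 1 + a ^+ 2.
Proof.
move=> s0 s1 a0; have [a1|a1] := lerP a 1.
  apply: (@le_trans _ _ 1); last by rewrite lerDl sqr_ge0.
  apply: (@le_trans _ _ ((1 : R) `^ (2 * s))); last by rewrite powR1.
  by apply: ge0_ler_powR; rewrite ?nnegrE ?mulr_ge0.
apply: (@le_trans _ _ (a ^+ 2)); last by rewrite lerDr.
by rewrite -powR_mulrn// ler_powR ?(ltW a1)//; lra.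
Qed.

(** The multiplier inequality is used at [a = S * norm3 y], since the frequency scale of the shell
    is [1 / S]. The three coordinates of [y] have the same bound by symmetry, whence
    [108 = 3 * 6^2]. *)
Lemma integral_energy_Hs (s C : R) : 0 <= s -> s <= 1 -> 0 <= C ->
  (forall t : R, t <= 1 -> `|flat (flat_deriv 1) t| <= C) ->
  (\int[leb3]_y (norm3 y `^ (2 * s) * energyS y)%:E <=
   (S `^ (- (2 * s)) * (plconst * (216 * (1 + 108 * C ^+ 2)) *
     (amp ^+ 2 * lam ^+ 2 * S)))%:E)%E.
Proof.
move=> s0 s1 C0 hC.
have mE := measurable_energy S_gt0 Slam amp_gt0.
have E0 := energy_ge0 S lam amp.
have m11 : measurable_fun [set: M3] (fun x : M3 => x.1.1).
  exact: measurableT_comp measurable_fst measurable_fst.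
have m12 : measurable_fun [set: M3] (fun x : M3 => x.1.2).
  exact: measurableT_comp measurable_snd measurable_fst.
have m2 : measurable_fun [set: M3] (fun x : M3 => x.2) by exact: measurable_snd.
have mI (f : M3 -> R) : measurable_fun [set: M3] f ->
    measurable_fun [set: M3] (fun y => (f y ^+ 2 * energyS y)%:E).
  by move=> mf; apply/measurable_EFinP; apply: measurable_funM => //; exact: measurable_funX.
have I0 (f : M3 -> R) y : (0 <= (f y ^+ 2 * energyS y)%:E)%E.
  by rewrite lee_fin mulr_ge0// sqr_ge0.
set B := (plconst * ((6 * C * amp / S) ^+ 2 * (216 * lam ^+ 2 * S)))%R.
have I3 := integral_energy_z C0 hC; rewrite -/B in I3.
have I2 : (\int[leb3]_y (y.1.2 ^+ 2 * energyS y)%:E <= B%:E)%E.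
  apply: le_trans I3; rewrite le_eqVlt; apply/orP; left; apply/eqP.
  apply: (etrans (integral_swap23 (mI _ m12))); apply: eq_integral => y _.
  by rewrite energy_swap23.
have I1 : (\int[leb3]_y (y.1.1 ^+ 2 * energyS y)%:E <= B%:E)%E.
  apply: le_trans I2; rewrite le_eqVlt; apply/orP; left; apply/eqP.
  apply: (etrans (integral_swap12 (mI _ m11))); apply: eq_integral => y _.
  by rewrite energy_swap12.
have S2 : 0 <= S `^ (- (2 * s)) by exact: powR_ge0.
have mEE : measurable_fun [set: M3] (fun y => (energyS y)%:E) by exact/measurable_EFinP.
have EE0 y : (0 <= (energyS y)%:E)%E by rewrite lee_fin.
pose G (y : M3) := ((y.1.1 ^+ 2 * energyS y)%:E + ((y.1.2 ^+ 2 * energyS y)%:E + (y.2 ^+ 2 *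
  energyS y)%:E))%E.
have mG : measurable_fun [set: M3] G.
  by apply: emeasurable_funD; [exact: mI|apply: emeasurable_funD; exact: mI].
have G0 y : (0 <= G y)%E.
  apply: adde_ge0; first exact: (I0 (fun y => y.1.1)).
  by apply: adde_ge0; [exact: (I0 (fun y => y.1.2))|exact: (I0 (fun y => y.2))].
apply: (@le_trans _ _ (\int[leb3]_y ((S `^ (- (2 * s)))%:E *
   ((energyS y)%:E + (S ^+ 2)%:E * G y)))%E).
  apply: ge0_le_integral => //.
  - by move=> y _; rewrite lee_fin mulr_ge0 ?powR_ge0.
  - apply/measurable_EFinP; apply: measurable_funM => //.
    apply: measurableT_comp (@measurable_powR R _) _.
    apply: (@measurableT_comp _ _ _ _ _ _ (@Num.sqrt R)).
      by apply: continuous_measurable_fun; exact: sqrt_continuous.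
    exact: measurable_dot3.
  - apply: measurable_funeM; apply: emeasurable_funD => //.
    exact: measurable_funeM.
  - move=> y _; rewrite /G -!(EFinM, EFinD) lee_fin.
    rewrite (_ : _ + _ * _ = (1 + (S * norm3 y) ^+ 2) * energyS y); last first.
      have -> : (S * norm3 y) ^+ 2 = S ^+ 2 * dot3 y y.
        by rewrite exprMn sqr_sqrtr// /dot3 -!expr2 !addr_ge0 ?sqr_ge0.
      by rewrite /dot3; ring.
    rewrite mulrA ler_wpM2r//.
    have n0 : 0 <= norm3 y by exact: sqrtr_ge0.
    rewrite -ler_pdivrMl; last by rewrite powR_gt0.
    rewrite -powRN opprK -powRM ?(ltW S_gt0)//.
    by apply: powR_le1Dsqr => //; rewrite mulr_ge0 ?(ltW S_gt0).
rewrite ge0_integralZl//; last 2 first.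
- by apply: emeasurable_funD => //; exact: measurable_funeM.
- by move=> y _; rewrite adde_ge0// mule_ge0// lee_fin sqr_ge0.
rewrite (EFinM (S `^ _)); apply: lee_wpmul2l; first by rewrite lee_fin.
rewrite ge0_integralD//; last 2 first.
- by move=> y _; rewrite mule_ge0// lee_fin sqr_ge0.
- exact: measurable_funeM.
rewrite ge0_integralZl//; last by rewrite lee_fin sqr_ge0.
rewrite /G ge0_integralD; last first.
- by apply: emeasurable_funD; exact: mI.
- by move=> y _; apply: adde_ge0; [exact: (I0 (fun y => y.1.2))|exact: (I0 (fun y => y.2))].
- exact: mI.
- by move=> y _; exact: (I0 (fun y => y.1.1)).
- by [].
rewrite ge0_integralD; last first.
- exact: mI.
- by move=> y _; exact: (I0 (fun y => y.2)).
- exact: mI.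
- by move=> y _; exact: (I0 (fun y => y.1.2)).
- by [].
apply: (@le_trans _ _ ((plconst * (amp ^+ 2 * (216 * lam ^+ 2 * S)))%:E +
   (S ^+ 2)%:E * (B%:E + (B%:E + B%:E)))%E).
  apply: leeD; first exact: integral_energy.
  apply: lee_wpmul2l; first by rewrite lee_fin sqr_ge0.
  by apply: leeD => //; exact: leeD.
rewrite -!(EFinM, EFinD) lee_fin le_eqVlt; apply/orP; left; apply/eqP.
by rewrite /B; field; rewrite gt_eqF.
Qed.

End Estimates.

(** * The shell as an element of the space *)

Section TestFunction.
Variable R : realType.
Local Notation R3 := (R * R * R)%type.
Local Notation M := (measurableTypeR R).
Local Notation M3 := (M * M * M)%type.
Local Notation C := (complex R).

Variables (S lam amp : R).
Hypotheses (S_gt0 : 0 < S) (Slam : 4 * S <= lam) (amp_gt0 : 0 < amp).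

Let lam_gt0 : 0 < lam. Proof. by apply: lt_le_trans Slam; rewrite mulr_gt0. Qed.

Local Notation bumpS := (bump S lam amp).
Local Notation shellS := (shell S lam).
Local Notation energyS := (energy S lam amp).

Definition cbump (x : R3) : C := Complex (bumpS x) 0.

Lemma normc_cbump x : normc (cbump x) = bumpS x.
Proof.
by rewrite /normc /cbump expr0n addr0 sqrtr_sqr ger0_norm// bump_ge0.
Qed.

Lemma smooth_expr_bump : smooth_expr bumpS.
Proof.
pose sq (x : R3) := x.1.1 * x.1.1 + x.1.2 * x.1.2 + x.2 * x.2.
have ssq : smooth_expr sq.
  by apply: SE_add; [apply: SE_add|]; apply: SE_mul;
    solve [exact: SE_x|exact: SE_y|exact: SE_z].
pose w (x : R3) := (sq x + - lam ^+ 2) * (lam * S)^-1.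
have sw : smooth_expr w.
  by apply: SE_mul; [apply: SE_add|]; solve [exact: ssq|exact: SE_cst].
apply: (@eq_smooth_expr R (fun x => amp * flat 1 (1 + -1 * (w x * w x)))).
  by move=> x; rewrite /bump /prof /thick mulN1r -expr2.
apply: SE_mul; first exact: SE_cst.
apply: SE_flat; apply: SE_add; first exact: SE_cst.
by apply: SE_mul; [exact: SE_cst|exact: SE_mul].
Qed.

Lemma test_fun_cbump : test_fun cbump.
Proof.
split.
  move=> n; split; first exact: smooth_expr_Ck smooth_expr_bump.
  by apply: smooth_expr_Ck; exact: SE_cst.
set L := 3 / 2 * lam.
pose B : set R3 := `[- L, L] `*` `[- L, L] `*` `[- L, L].
have cB : compact B by do 2?apply: compact_setX; exact: segment_compact.
have clB : closed B by apply: compact_closed => //; exact: norm_hausdorff.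
apply: subclosed_compact cB _; first exact: closed_closure.
rewrite ((closure_id _).1 clB); apply: closureS => x /= nx.
have b0 : bumpS x != 0.
  by apply: contra nx => /eqP e; rewrite /cbump e.
have sx : shellS x = 1.
  have [//|s0] := shell_01 S lam x.
  have := bump_le S lam amp_gt0 x; rewrite s0 mulr0 normr_le0 => e.
  by rewrite e in b0.
have := shell_box3 S_gt0 Slam x; rewrite sx /box3 /box1 -/L.
case: (lerP `|x.1.1| L) => [x1|_]; last by rewrite !mul0r ler10.
case: (lerP `|x.1.2| L) => [x2|_]; last by rewrite mulr0 mul0r ler10.
case: (lerP `|x.2| L) => [x3 _|_]; last by rewrite mulr0 ler10.
by do 2?split; rewrite /= in_itv/= -ler_norml.
Qed.

Lemma Cmeasurable_cbump : Cmeasurable cbump.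
Proof.
by split; [exact: measurable_bump|exact: measurable_cst].
Qed.

Lemma Lp_norm_cbump (p : R) :
  Lp_norm p cbump = ((\int[leb3]_x (bumpS x `^ p)%:E) `^ p^-1)%E.
Proof.
rewrite /Lp_norm Lnorm.unlock; apply: (congr1 (fun I => I `^ p^-1)%E);
  apply: eq_integral => x _.
by rewrite normc_cbump /= ger0_norm ?bump_ge0.
Qed.

Lemma in_Lp_cbump (p : R) : 0 < p -> in_Lp p cbump.
Proof.
move=> p0; split; first exact: Cmeasurable_cbump.
rewrite Lp_norm_cbump; apply: poweR_lty.
have L0 : 0 < 3 / 2 * lam by rewrite mulr_gt0.
apply: (@le_lt_trans _ _ (\int[leb3]_x ((amp `^ p)%:E * (box3 (3 / 2 * lam) x)%:E))%E).
  apply: ge0_le_integral => //.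
  - by move=> x _; rewrite lee_fin powR_ge0.
  - apply/measurable_EFinP; apply: measurableT_comp (@measurable_powR R p) _.
    exact: measurable_bump.
  - by apply: measurable_funeM; apply/measurable_EFinP; exact: measurable_box3.
  - move=> x _; rewrite -EFinM lee_fin.
    have := bump_box3 S_gt0 Slam amp_gt0 x.
    rewrite ger0_norm ?bump_ge0//.
    have [->|->] := box3_01 (3 / 2 * lam) x.
      by rewrite !mulr1 => h; apply: ge0_ler_powR; rewrite ?nnegrE ?bump_ge0// ltW.
    rewrite !mulr0 => h; have -> : bumpS x = 0.
      by apply/eqP; rewrite eq_le h bump_ge0.
    by rewrite powR0// gt_eqF.
rewrite ge0_integralZl//.
- by rewrite integral_box3 ?ltW// -EFinM ltry.
- by apply/measurable_EFinP; exact: measurable_box3.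
- by move=> x _; rewrite lee_fin box3_ge0.
- by rewrite lee_fin powR_ge0.
Qed.

Lemma radial_cbump : radial cbump.
Proof.
exists (fun r => Complex (prof S lam amp (r ^+ 2)) 0).
apply: aeW => x; rewrite /cbump /bump /norm3 sqr_sqrtr//.
by rewrite /dot3 -!expr2 !addr_ge0 ?sqr_ge0.
Qed.

Lemma fourier_cbump (y : R3) :
  normc (fourier cbump y) ^+ 2 = ((2 * pi) `^ (- (3 / 2))) ^+ 2 * energyS y.
Proof.
rewrite /fourier normcM exprMn.
have -> : Cintegral (fun x => cexpN (dot3 x y) * cbump x) =
    Complex (fcos bumpS y) (- fsin bumpS y).
  rewrite /Cintegral; congr Complex.
    by apply: eq_Rintegral => x _; rewrite /= mulr0 subr0 mulrC.
  rewrite -mulN1r /fsin -RintegralZl//.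
    by apply: eq_Rintegral => x _; rewrite /= mulr0 add0r; ring.
  have L0 : 0 < 3 / 2 * lam by rewrite mulr_gt0.
  apply: (integrable_bounded (ltW L0) (B := amp)).
    apply: measurable_funM; first exact: measurable_bump.
    apply: (@measurableT_comp _ _ _ _ _ _ (@sin R)); last exact: measurable_dot3.
    by apply: continuous_measurable_fun; exact: continuous_sin.
  move=> x; rewrite normrM (le_trans _ (bump_box3 S_gt0 Slam amp_gt0 x))// ler_piMr//.
  by rewrite ler_norml sin_geN1 sin_le1.
rewrite [X in _ * X](_ : _ = energyS y); last first.
  by rewrite /normc sqr_sqrtr ?addr_ge0 ?sqr_ge0// sqrrN.
by rewrite /normc /real_complex_def expr0n addr0 sqr_sqrtr ?sqr_ge0.
Qed.

(** Allows the normalization to be dropped from upper bounds on the Sobolev norm. *)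
Lemma fourier_const_le1 : ((2 * pi) `^ (- (3 / 2))) ^+ 2 <= 1 :> R.
Proof.
have pi2 : 1 <= 2 * pi :> R by have := pi_ge2 R; lra.
rewrite -[leRHS](expr1n _ 2) lerXn2r ?nnegrE ?powR_ge0//.
rewrite powRN invf_le1 ?powR_gt0//; last by rewrite mulr_gt0 ?pi_gt0.
apply: (@le_trans _ _ ((2 * pi) `^ 0)); first by rewrite powRr0.
by apply: ler_powR => //; rewrite divr_ge0.
Qed.

Lemma test_Hs_norm_cbump (s K : R) :
  (\int[leb3]_y (norm3 y `^ (2 * s) * energyS y)%:E <= K%:E)%E ->
  (test_Hs_norm s cbump <= (K%:E) `^ 2^-1)%E.
Proof.
move=> H.
have I0 : (0 <= \int[leb3]_y (norm3 y `^ (2 * s) * normc (fourier cbump y) ^+ 2)%:E)%E.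
  by apply: integral_ge0 => y _; rewrite lee_fin mulr_ge0 ?powR_ge0 ?sqr_ge0.
have J0 : (0 <= \int[leb3]_y (norm3 y `^ (2 * s) * energyS y)%:E)%E.
  by apply: integral_ge0 => y _; rewrite lee_fin mulr_ge0 ?powR_ge0 ?energy_ge0.
have mN : measurable_fun [set: M3] (fun y : M3 => norm3 y `^ (2 * s)).
  apply: measurableT_comp (@measurable_powR R _) _.
  apply: (@measurableT_comp _ _ _ _ _ _ (@Num.sqrt R)).
    by apply: continuous_measurable_fun; exact: sqrt_continuous.
  exact: measurable_dot3.
have mE := measurable_energy S_gt0 Slam amp_gt0.
have HK : (\int[leb3]_y (norm3 y `^ (2 * s) * normc (fourier cbump y) ^+ 2)%:E <= K%:E)%E.
  apply: le_trans H; under eq_integral do rewrite fourier_cbump.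
  apply: ge0_le_integral => //.
  - by move=> y _; rewrite lee_fin mulr_ge0 ?powR_ge0// mulr_ge0 ?sqr_ge0 ?energy_ge0.
  - by apply/measurable_EFinP; apply: measurable_funM => //; exact: measurable_funM.
  - by apply/measurable_EFinP; exact: measurable_funM.
  - move=> y _; rewrite lee_fin ler_wpM2l ?powR_ge0// ler_piMl ?energy_ge0//.
    exact: fourier_const_le1.
apply: gt0_ler_poweR => //; rewrite in_itv/= leey andbT//.
exact: le_trans HK.
Qed.

(** All differences vanish identically; [s < 3 / 2] keeps the Lebesgue exponent positive. *)
Lemma Hs_approx_cst (s : R) : s < 3 / 2 -> Hs_approx s cbump (fun=> cbump).
Proof.
move=> s32.
have e0 : (fun x : R3 => cbump x - cbump x) = (fun=> 0 : C).
  by apply/funext => x; rewrite subrr.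
split; first by move=> _; exact: test_fun_cbump.
- move=> e e_gt0; exists 0%N => m n _ _; rewrite e0 /test_Hs_norm.
  have F0 y : fourier (fun=> 0 : C) y = 0.
    rewrite /fourier (_ : (fun x : R3 => cexpN (dot3 x y) * (0 : C)) = (fun=> 0)).
      by rewrite /Cintegral /Rintegral integral0 (_ : Complex _ _ = 0) ?mulr0.
    by apply/funext => x; rewrite mulr0.
  under eq_integral do rewrite F0 normc0 expr0n mulr0.
  by rewrite integral0 poweR0r// lte_fin.
- rewrite e0 /Lp_norm.
  rewrite (_ : (fun x : M3 => (normc (0 : C))%:E) = cst 0%E); last first.
    by apply/funext => x; rewrite normc0.
  by rewrite Lnorm0 ?gt_eqF//; [exact: cvg_cst|rewrite lte_fin divr_gt0//; lra].
Qed.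

Lemma in_Hs_cbump (s : R) : s < 3 / 2 -> in_Hs s cbump.
Proof.
move=> s32; split; last by exists (fun=> cbump); exact: Hs_approx_cst.
by apply: in_Lp_cbump; rewrite divr_gt0//; lra.
Qed.

(** The constant sequence competes in the infimum. Nonnegativity is recorded because the norm is
    squared later. *)
Lemma Hs_norm_cbump_le (s : R) : s < 3 / 2 ->
  (0 <= Hs_norm s cbump <= test_Hs_norm s cbump)%E.
Proof.
move=> s32; apply/andP; split.
  apply: le_ereal_inf_tmp => l [u _ ul]; apply: (cvge_ge _ ul).
  by near=> n; exact: poweR_ge0.
apply: ereal_inf_lbound; exists (fun=> cbump); first exact: Hs_approx_cst.
exact: cvg_cst.
Unshelve. all: by end_near. Qed.

(** Tonelli: at a point of the shell the potential is at most [1152 * lam * S], and the shell has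
    volume at most [216 * lam^2 * S]; each squared bump contributes [amp^2]. *)
Lemma coulomb_cbump_le :
  (coulomb cbump <= (216 * 1152 * (amp ^+ 4 * lam ^+ 3 * S ^+ 2))%:E)%E.
Proof.
have mf : measurable_fun [set: (M3 * M3)%type]
  (fun z => bumpS z.1 ^+ 2 * bumpS z.2 ^+ 2 / norm3 (z.1 - z.2)).
  have mb := measurable_bump amp S_gt0 Slam.
  apply: measurable_funM.
    apply: measurable_funM; apply: measurable_funX.
      exact: measurableT_comp mb measurable_fst.
    exact: measurableT_comp mb measurable_snd.
  by apply: measurable_inv_norm3; [exact: measurable_fst|exact: measurable_snd].
pose g (z : M3 * M3) : \bar R := (bumpS z.1 ^+ 2 * bumpS z.2 ^+ 2 / norm3 (z.1 - z.2))%:E.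
have mg : measurable_fun [set: (M3 * M3)%type] g by exact/measurable_EFinP.
have g0 z : (0 <= g z)%E.
  by rewrite lee_fin; apply: divr_ge0; [rewrite mulr_ge0 ?sqr_ge0|exact: sqrtr_ge0].
have -> : coulomb cbump = (\int[leb3 \x leb3]_z g z)%E.
  by apply: eq_integral => z _; rewrite !normc_cbump.
rewrite (@fubini_tonelli1 _ _ M3 M3 R leb3 leb3 g mg g0) /fubini_F.
have bsq x : bumpS x ^+ 2 <= amp ^+ 2 * shellS x.
  have := bump_le S lam amp_gt0 x; rewrite ger0_norm ?bump_ge0//.
  have [->|->] := shell_01 S lam x; rewrite ?mulr1 ?mulr0 => h.
    by rewrite lerXn2r ?nnegrE ?bump_ge0// ltW.
  have -> : bumpS x = 0 by apply/eqP; rewrite eq_le h bump_ge0.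
  by rewrite expr0n.
have mS : measurable_fun [set: M3] (fun x => (shellS x)%:E).
  by apply/measurable_EFinP; exact: measurable_shell.
have inner x : (\int[leb3]_y g (x, y) <= (amp ^+ 4 * (1152 * lam * S))%:E * (shellS x)%:E)%E.
  have [hx|hx] := shell_01 S lam x; last first.
    rewrite hx mule0 (eq_integral (fun=> 0%E)) ?integral0// => y _.
    have := bsq x; rewrite hx mulr0 /g/= => h.
    have -> : bumpS x ^+ 2 = 0 by apply/eqP; rewrite eq_le h sqr_ge0.
    by rewrite !mul0r.
  rewrite hx mule1; apply: (@le_trans _ _ (\int[leb3]_y ((amp ^+ 4)%:E * (shellS y / norm3 (x
    - y))%:E))%E).
    have mk : measurable_fun [set: M3] (fun y : M3 => shellS y / norm3 (x - y)).
      apply: measurable_funM; first exact: measurable_shell.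
      by apply: measurable_inv_norm3; [exact: measurable_cst|].
    apply: ge0_le_integral => //.
    - exact: (measurableT_comp mg (pair1_measurable x)).
    - by apply: measurable_funeM; exact/measurable_EFinP.
    - move=> y _; rewrite -EFinM lee_fin [leRHS]mulrA.
      apply: ler_wpM2r; first by rewrite invr_ge0 sqrtr_ge0.
      rewrite (_ : amp ^+ 4 * shellS y = (amp ^+ 2 * 1) * (amp ^+ 2 * shellS y)); last by ring.
      by apply: ler_pM; rewrite ?sqr_ge0// -hx.
  rewrite ge0_integralZl//; last 3 first.
  - apply/measurable_EFinP; apply: measurable_funM; first exact: measurable_shell.
    by apply: measurable_inv_norm3; [exact: measurable_cst|].
  - by move=> y _; rewrite lee_fin divr_ge0 ?shell_ge0 ?sqrtr_ge0.
  - by rewrite lee_fin exprn_ge0// ltW.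
  rewrite (EFinM (amp ^+ 4)); apply: lee_wpmul2l; first by rewrite lee_fin exprn_ge0// ltW.
  exact: integral_shell_coulomb.
have c0 : (0 <= (amp ^+ 4 * (1152 * lam * S))%:E :> \bar R)%E.
  rewrite lee_fin; apply: mulr_ge0; first by rewrite exprn_ge0// ltW.
  apply: mulr_ge0; last exact: ltW.
  by apply: mulr_ge0; [exact: ler0n|exact: ltW].
apply: (@le_trans _ _ (\int[leb3]_x ((amp ^+ 4 * (1152 * lam * S))%:E * (shellS x)%:E))%E).
  apply: ge0_le_integral => //.
  - by move=> x _; apply: integral_ge0.
  - exact: (@measurable_fun_fubini_tonelli_F _ _ M3 M3 R leb3 g mg g0).
  - exact: measurable_funeM.
rewrite ge0_integralZl//; last by move=> x _; rewrite lee_fin shell_ge0.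
apply: le_trans (lee_wpmul2l c0 (integral_shell_vol S_gt0 Slam)) _.
by rewrite -EFinM lee_fin le_eqVlt; apply/orP; left; apply/eqP; ring.
Qed.

Lemma in_Es_cbump (s : R) : s < 3 / 2 -> in_Es s cbump.
Proof.
move=> s32; split; [exact: in_Hs_cbump|exact: radial_cbump|].
by apply: le_lt_trans coulomb_cbump_le _; rewrite ltry.
Qed.

End TestFunction.

(** * * Choice of the parameters and conclusion *)

Section Conclusion.
Variable R : realType.

Lemma Es_norm_cbump_le (s S C : R) : 1 / 2 < s -> s <= 1 -> 4 <= S -> 0 <= C ->
  (forall t : R, t <= 1 -> `|flat (flat_deriv 1) t| <= C) ->
  let lam := S `^ (4 * s) in
  let amp := S `^ (- ((6 * s + 1) / 2)) in
  [/\ 0 < S, 4 * S <= lam, 0 < amp &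
   (Es_norm s (cbump S lam amp) <=
    ((plconst R * (216 * (1 + 108 * C ^+ 2)) + (216 * 1152) `^ 2^-1) `^ 2^-1)%:E)%E].
Proof.
move=> hs hs1 S4 C0 hC lam amp.
have S0 : 0 < S by apply: lt_le_trans S4.
have S_neq0 : S != 0 by rewrite gt_eqF.
have amp0 : 0 < amp by exact: powR_gt0.
have Slam : 4 * S <= lam.
  (* [4 <= S] gives [4 * S <= S^2], and [1 / 2 < s] gives [2 <= 4 * s]. *)
  apply: (@le_trans _ _ (S ^+ 2)); first by rewrite expr2 ler_pM2r.
  rewrite -powR_mulrn ?(ltW S0)//; apply: ler_powR; last by lra.
  by apply: le_trans S4; lra.
have XD (a b : R) : S `^ a * S `^ b = S `^ (a + b) by rewrite powRD// S_neq0 implybT.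
have XX (a : R) n : (S `^ a) ^+ n = S `^ (a * n%:R).
  by rewrite powRrM powR_mulrn ?powR_ge0.
have X1 : S `^ 1 = S by rewrite powRr1// ltW.
split=> //.
set K1 := plconst R * _.
have K10 : 0 <= K1.
  apply: mulr_ge0; first exact: plconst_ge0.
  by apply: mulr_ge0; [exact: ler0n|rewrite addr_ge0// mulr_ge0// sqr_ge0].
have s32 : s < 3 / 2 by lra.
have s0 : 0 <= s by lra.
have Hint := integral_energy_Hs S0 Slam amp0 s0 hs1 C0 hC.
(* The exponents cancel: [-2s - (6s + 1) + 8s + 1 = 0]. *)
have e1 : S `^ (- (2 * s)) * (K1 * (amp ^+ 2 * lam ^+ 2 * S)) = K1.
  rewrite mulrCA -[RHS]mulr1; congr (_ * _); rewrite /amp /lam !XX -{4}X1 !XD.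
  by rewrite -[RHS](powRr0 S); congr (_ `^ _); field.
rewrite e1 in Hint.
(* Here [-2(6s + 1) + 12s + 2 = 0]. *)
have e2 : amp ^+ 4 * lam ^+ 3 * S ^+ 2 = 1.
  by rewrite /amp /lam !XX -{3}X1 XX !XD -[RHS](powRr0 S); congr (_ `^ _); field.
have Hc := coulomb_cbump_le S0 Slam amp0.
rewrite e2 mulr1 in Hc.
have /andP[H0 H1] := Hs_norm_cbump_le S0 Slam amp0 s32.
have Hs := le_trans H1 (test_Hs_norm_cbump S0 Slam amp0 Hint).
have Hs2 : (Hs_norm s (cbump S lam amp) ^+ 2 <= K1%:E)%E.
  rewrite (_ : K1%:E = (K1%:E `^ 2^-1) ^+ 2)%E; last first.
    by rewrite poweR_EFin -EFin_expe -powR_mulrn ?powR_ge0// -powRrM mulVf// powRr1.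
  by rewrite !expe2; apply: lee_pmul.
have c0 : (0 <= coulomb (cbump S lam amp))%E.
  apply: integral_ge0 => z _; rewrite lee_fin divr_ge0 ?sqrtr_ge0//.
  by rewrite mulr_ge0 ?sqr_ge0.
have pos (x : \bar R) : (0 <= x)%E -> x \in `[0%E, +oo%E].
  by move=> x0; rewrite in_itv/= x0 leey.
have Hc2 : (coulomb (cbump S lam amp) `^ 2^-1 <= (216 * 1152)%:E `^ 2^-1)%E.
  apply: gt0_ler_poweR => //; first exact: pos.
  by apply: pos; rewrite lee_fin; apply: mulr_ge0; exact: ler0n.
have hsum : (Hs_norm s (cbump S lam amp) ^+ 2 + coulomb (cbump S lam amp) `^ 2^-1 <=
   (K1 + (216 * 1152) `^ 2^-1)%:E)%E by rewrite EFinD; exact: leeD.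
rewrite /Es_norm -poweR_EFin; apply: gt0_ler_poweR => //; apply: pos.
  by apply: adde_ge0; [rewrite expe_ge0|exact: poweR_ge0].
by rewrite lee_fin addr_ge0 ?powR_ge0.
Qed.

End Conclusion.

Theorem theorem0p4 (R : realType) (s : R) (hs : 1 / 2 < s) (hs1 : s <= 1)
  (p : R) (hp1 : 1 <= p) (hp : p < (16 * s + 2) / (6 * s + 1)) :
  ~ Es_embedded s p.
Proof.
move=> [K emb].
have [C C0 hC] := flat_deriv_bounded R.
have p0 : 0 < p by lra.
have p_neq0 : p != 0 by rewrite gt_eqF.
have s61 : 0 < 6 * s + 1 by lra.
(* The exponent of [S] in the lower bound for the L^p integral; its positivity is a restatement of
   [hp]. *)
have g0 : 0 < 8 * s + 1 - p * ((6 * s + 1) / 2).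
  by move: hp; rewrite ltr_pdivlMr// => hp; lra.
set g := 8 * s + 1 - _ in g0.
set e0 : R := expR (- (4 / 3)).
have e0_gt0 : 0 < e0 by exact: expR_gt0.
pose B := (plconst R * (216 * (1 + 108 * C ^+ 2)) + (216 * 1152) `^ 2^-1) `^ 2^-1.
have B0 : 0 <= B by exact: powR_ge0.
have growth (S : R) : 4 <= S -> e0 `^ p * S `^ g / 32 <= (`|K| * B) `^ p.
  move=> S4; have [S0 Slam amp0] := Es_norm_cbump_le hs hs1 S4 C0 hC.
  rewrite -/B; set lam := S `^ _ in Slam *; set amp := S `^ _ in amp0 * => HE.
  have s32 : s < 3 / 2 by lra.
  have [_ HL] := emb _ (in_Es_cbump S0 Slam amp0 s32).
  have I0 : (0 <= \int[leb3]_x (bump S lam amp x `^ p)%:E)%E.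
    by apply: integral_ge0 => x _; rewrite lee_fin powR_ge0.
  have HL2 : ((\int[leb3]_x (bump S lam amp x `^ p)%:E) `^ p^-1 <= (`|K| * B)%:E)%E.
    rewrite -Lp_norm_cbump//; apply: le_trans HL _.
    (* The sign of [K] is unknown, and multiplying the bound on [Es_norm] requires a nonnegative
       factor. *)
    apply: (@le_trans _ _ (`|K|%:E * Es_norm s (cbump S lam amp))%E).
      by apply: lee_wpmul2r; [exact: poweR_ge0|rewrite lee_fin ler_norm].
    by rewrite EFinM; apply: lee_wpmul2l.
  have HL3 : (\int[leb3]_x (bump S lam amp x `^ p)%:E <= ((`|K| * B) `^ p)%:E)%E.
    set I := (\int[_]_x _)%E in I0 HL2 *.
    have -> : I = ((I `^ p^-1) `^ p)%E by rewrite -poweRrM mulVf// poweRe1.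
    rewrite -poweR_EFin.
    apply: gt0_ler_poweR => //; first exact: ltW.
      by rewrite in_itv/= poweR_ge0 leey.
    by rewrite in_itv/= leey andbT lee_fin mulr_ge0.
  have := le_trans (integral_bump_ge S0 Slam amp0 (ltW p0)) HL3.
  rewrite lee_fin; apply: le_trans; rewrite le_eqVlt; apply/orP; left; apply/eqP.
  have S_neq0 : S != 0 by rewrite gt_eqF.
  rewrite powRM ?(ltW e0_gt0) ?(ltW amp0)// -/e0.
  rewrite /amp /lam -powRrM -(powR_mulrn 2) ?powR_ge0// -powRrM.
  have -> : S `^ g = S `^ (- ((6 * s + 1) / 2) * p) * S `^ (4 * s * 2%:R) * S.
    rewrite -{4}(powRr1 (ltW S0)) -!powRD ?S_neq0 ?implybT//.
    by congr (_ `^ _); rewrite /g; field.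
  by field.
(* [growth] says that [S^g <= X] for all [S >= 4]. The choice [S = (4 + X)^(1 + 1/g)] is at least 4
   and has [S^g = (4 + X)^(g + 1) >= 4 + X], a contradiction. *)
pose X := 32 * (`|K| * B) `^ p / e0 `^ p.
have X0 : 0 <= X by rewrite divr_ge0 ?powR_ge0// mulr_ge0 ?powR_ge0.
have X4 : 1 <= 4 + X by lra.
have X4_neq0 : 4 + X != 0 by rewrite gt_eqF//; lra.
have big : 4 <= (4 + X) `^ (1 + g^-1).
  apply: (@le_trans _ _ ((4 + X) `^ 1)); first by rewrite powRr1; lra.
  by apply: ler_powR => //; rewrite lerDl invr_ge0 ltW.
have := growth _ big; rewrite -powRrM mulrDl mul1r mulVf ?gt_eqF// => H.
have : 4 + X <= (4 + X) `^ (g + 1).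
  apply: (@le_trans _ _ ((4 + X) `^ 1)); first by rewrite powRr1; lra.
  by apply: ler_powR => //; lra.
have e0p : 0 < e0 `^ p by exact: powR_gt0.
have : (4 + X) `^ (g + 1) <= X.
  rewrite /X ler_pdivlMr// mulrC; lra.
lra.
Qed.
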